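(* Let $X$ be a reflexive Banach space and $Y$ a Hilbert space, and let $\Theta:X\to(-\infty,\infty]$ be a proper, lower semi-continuous, $2$-convex function (with constant $\gamma$). Let $F$ satisfy conditions (a)--(d) of the context and let $\{\alpha_n\}$ satisfy $\alpha_n>0$, $1\le\alpha_n/\alpha_{n+1}\le\theta$ and $\lim_{n\to\infty}\alpha_n=0$ for some constant $\theta>1$. Assume that $x^\dagger$ is the unique solution of $F(x)=y$ in $B_\rho(x^\dagger)\cap D(F)$. If $\xi_0-\xi^\dagger\in\mathcal N(T)^\perp$ and $\mathcal E:=(K_0+K_1)\|\xi_0-\xi^\dagger\|$ is sufficiently small, then for the iteration $\{x_n^\delta\}$ terminated by either Rule 1, Rule 2 or Rule 3 (see context) with $\tau>1$, giving the integer $n_\delta$, there holds $x_{n_\delta}^\delta\to x^\dagger$ (in the norm of $X$) as $\delta\to0$.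
   Context: $\|\cdot\|$ denotes the norms of $X$, $Y$ and the dual norm of $X^*$; $\langle\xi,x\rangle=\xi(x)$ for $\xi\in X^*$, $x\in X$. Convexity. For a proper convex $\Theta:X\to(-\infty,\infty]$: $D(\Theta)=\{x:\Theta(x)<\infty\}$; $\partial\Theta(x)=\{\xi\in X^*:\Theta(z)-\Theta(x)-\langle\xi,z-x\rangle\ge0\ \forall z\in X\}$; $D(\partial\Theta)=\{x\in D(\Theta):\partial\Theta(x)\neq\emptyset\}$; for $\xi\in\partial\Theta(x)$ the Bregman distance is $D_\xi\Theta(z,x)=\Theta(z)-\Theta(x)-\langle\xi,z-x\rangle$. $\Theta$ is $2$-convex if there is $C_0>0$ with $\Theta(\lambda z+(1-\lambda)x)+C_0\lambda(1-\lambda)\|z-x\|^2\le\lambda\Theta(z)+(1-\lambda)\Theta(x)$ for all $x,z\in X$, $\lambda\in(0,1)$; equivalently, there is $\gamma>0$ with $\|z-x\|\le\gamma[D_\xi\Theta(z,x)]^{1/2}$ for all $z\in X$, $x\in D(\partial\Theta)$, $\xi\in\partial\Theta(x)$. Such a constant $\gamma$ is fixed. Operator. $F:D(F)\subset X\to Y$ is a (nonlinear) operator, $y\in Y$, $B_\rho(x^\dagger)=\{x\in X:\|x-x^\dagger\|<\rho\}$. Conditions on $F$: (a) $D(F)$ is closed and convex in $X$ and $F(x)=y$ has a solution $x^\dagger\in D(F)\cap D(\partial\Theta)$; (b) there is $\rho>0$ such that for each $x\in B_\rho(x^\dagger)\cap D(F)$ there is a bounded linear operator $F'(x):X\to Y$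 with $\lim_{t\searrow0}\frac{F(x+t(z-x))-F(x)}{t}=F'(x)(z-x)$ for all $z\in B_\rho(x^\dagger)\cap D(F)$; (c) $T:=F'(x^\dagger)$ is properly scaled so that $\|T\|\le\alpha_0^{1/2}/\gamma$; (d) there are constants $K_0,K_1\ge0$ with $\|[F'(z)-F'(x)]w\|\le K_0\|z-x\|\,\|F'(x)w\|+K_1\|F'(x)(z-x)\|\,\|w\|$ for all $w\in X$ and $x,z\in B_\rho(x^\dagger)\cap D(F)$. $\mathcal N(T)=\{x\in X:Tx=0\}$ and $\mathcal N(T)^\perp=\{\xi\in X^*:\langle\xi,x\rangle=0\ \forall x\in\mathcal N(T)\}$. Method. $\Theta_F(x)=\Theta(x)$ if $x\in D(F)$ and $+\infty$ otherwise. Given $\xi_0\in X^*$, $x_0:=\nabla\Theta_F^*(\xi_0)$ ($\Theta_F^*$ the Fenchel conjugate), i.e. $x_0$ is the unique minimizer of $\Theta_F(x)-\langle\xi_0,x\rangle$ over $X$, so $\xi_0\in\partial\Theta_F(x_0)$. $\xi^\dagger\in\partial\Theta_F(x^\dagger)$ is the unique element of $\partial\Theta_F(x^\dagger)$ with $\|\xi_0-\xi^\dagger\|$ equal to the distance from $\xi_0$ to $\partial\Theta_F(x^\dagger)$. For $\delta>0$ and $y^\delta\in Y$ with $\|y^\delta-y\|\le\delta$, set $x_0^\delta:=x_0$ and let $x_{n+1}^\delta$ be the unique minimizer over $x\in X$ of $$\|y^\delta-F(x_n^\delta)-F'(x_n^\delta)(x-x_n^\delta)\|^2+\alpha_nD_{\xi_0}\Theta_F(x,x_0),$$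 where $F'(x_n^\delta)$ is the operator from (b). Stopping rules, for given $\tau>1$. Rule 1: $n_\delta$ is the integer with $\|F(x_{n_\delta}^\delta)-y^\delta\|\le\tau\delta<\|F(x_n^\delta)-y^\delta\|$ for $0\le n<n_\delta$. Rule 2: if $\|F(x_0)-y^\delta\|\le\tau\delta$ then $n_\delta=0$; otherwise $n_\delta\ge1$ is the first integer with $\frac12(\|F(x_{n_\delta}^\delta)-y^\delta\|+\|F(x_{n_\delta-1}^\delta)-y^\delta\|)\le\tau\delta$. Rule 3: if $\|F(x_0)-y^\delta\|\le\tau\delta$ then $n_\delta=0$; otherwise $n_\delta\ge2$ is the first integer with $\max\{\|F(x_{n_\delta}^\delta)-y^\delta\|,\|F(x_{n_\delta-1}^\delta)-y^\delta\|\}\le\tau\delta$. ''Sufficiently small'' means: below a positive threshold independent of $n$, $\delta$ and $y^\delta$.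
   Formalization: If K_0+K_1=0, smallness of E is void and x_0 may lie outside B_rho(x†), where the claim can fail; in that case only, the formal theorem also assumes that the iterates produced up to termination lie in B_rho(x†). *)

(* Defs.v *)
From HB Require Import structures.
From mathcomp Require Import all_boot all_order all_algebra.
From mathcomp Require Import all_classical all_reals all_analysis.

Set Implicit Arguments.
Unset Strict Implicit.
Unset Printing Implicit Defensive.

Import Order.TTheory GRing.Theory Num.Theory.
Import numFieldNormedType.Exports.

Local Open Scope classical_set_scope.
Local Open Scope ring_scope.

Definition bounded_linear (R : realType) (V W : normedModType R)
    (f : V -> W) : Prop := linear f /\ continuous f.

(* Operator norm; for [W := R^o] it is the dual norm. Meaningful only for
   [bounded_linear] maps, since [sup] of an unbounded set is 0. *)
Definition opnorm (R : realType) (V W : normedModType R) (f : V -> W) : R :=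
  sup [set `|f x| | x in [set x : V | `|x| <= 1]].

(* The dual space, as a set of functions; sums, differences and multiples of
   its elements are taken pointwise. *)
Definition dual_space (R : realType) (V : normedModType R) : set (V -> R^o) :=
  [set xi | bounded_linear xi].
Arguments dual_space {R} V _.

(* Every bounded linear functional on the dual is the evaluation at a point. *)
Definition reflexive_space (R : realType) (V : normedModType R) : Prop :=
  forall phi : (V -> R^o) -> R,
    (forall a xi eta, dual_space V xi -> dual_space V eta ->
      phi (a *: xi + eta) = a * phi xi + phi eta) ->
    (exists C, forall xi, dual_space V xi -> `|phi xi| <= C * opnorm xi) ->
    exists x, forall xi, dual_space V xi -> phi xi = xi x.

(* A complete normed space whose norm comes from an inner product. *)
Definition hilbert_space (R : realType) (Y : completeNormedModType R) : Prop :=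
  exists ip : Y -> Y -> R,
    [/\ forall u v, ip u v = ip v u,
        forall a u v w, ip (a *: u + v) w = a * ip u w + ip v w
      & forall u, ip u u = `|u| ^+ 2].

Section ConvexAnalysis.
Context {R : realType} {X : normedModType R}.
Implicit Types (Theta f : X -> \bar R) (xi eta : X -> R^o) (x z : X).
Local Open Scope ereal_scope.

Definition proper_fun Theta : Prop :=
  (forall x, -oo < Theta x) /\ exists x, Theta x < +oo.

Definition dom Theta : set X := [set x | Theta x < +oo].

Definition bregman Theta xi z x : \bar R :=
  Theta z - Theta x - (xi (z - x)%R)%:E.

(* Empty when [Theta x = +oo], because [+oo - +oo = -oo] in [\bar R]. *)
Definition subdiff Theta x : set (X -> R^o) :=
  [set xi | dual_space X xi /\ forall z, 0 <= bregman Theta xi z x].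

Definition dom_subdiff Theta : set X := [set x | dom Theta x /\ subdiff Theta x !=set0].

Definition two_convex Theta : Prop :=
  exists2 C0 : R, (0 < C0)%R &
    forall x z (l : R), (0 < l < 1)%R ->
      Theta (l *: z + (1 - l) *: x)%R + (C0 * l * (1 - l) * `|z - x| ^+ 2)%:E
      <= l%:E * Theta z + (1 - l)%:E * Theta x.

Definition two_convex_const Theta (gamma : R) : Prop :=
  (0 < gamma)%R /\
  forall z x xi, dom_subdiff Theta x -> subdiff Theta x xi ->
    `|z - x|%:E <= gamma%:E * sqrte (bregman Theta xi z x).

Definition unique_minimizer f x : Prop :=
  (forall z, f x <= f z) /\
  forall x', (forall z, f x' <= f z) -> x' = x.

Definition dual_dist xi (S : set (X -> R^o)) : R :=
  inf [set opnorm (xi - eta)%R | eta in S].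

Definition unique_nearest xi (S : set (X -> R^o)) eta : Prop :=
  [/\ S eta, opnorm (xi - eta)%R = dual_dist xi S
    & forall eta', S eta' -> opnorm (xi - eta')%R = dual_dist xi S -> eta' = eta].

(* [Theta] on [D], [+oo] elsewhere. *)
Definition restrict_fun Theta (D : set X) : X -> \bar R :=
  patch (cst +oo) D Theta.

End ConvexAnalysis.

Section Operator.
Context {R : realType} {X Y : normedModType R}.

(* [F] is total, but only its values on the domain [DF] matter; likewise
   [dF x] matters only for [x] in the ball and in [DF]. *)
Definition has_directional_derivatives (F : X -> Y) (DF : set X)
    (dF : X -> X -> Y) (xdag : X) (rho : R) : Prop :=
  forall x, (ball xdag rho `&` DF) x ->
    bounded_linear (dF x) /\
    forall z, (ball xdag rho `&` DF) z ->
      t^-1 *: (F (x + t *: (z - x)) - F x) @[t --> (0 : R)^'+] --> dF x (z - x).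

Definition nonlinearity_condition (DF : set X) (dF : X -> X -> Y) (xdag : X)
    (rho K0 K1 : R) : Prop :=
  forall w x z, (ball xdag rho `&` DF) x -> (ball xdag rho `&` DF) z ->
    `|dF z w - dF x w| <=
      K0 * `|z - x| * `|dF x w| + K1 * `|dF x (z - x)| * `|w|.

(* The annihilator of the null space of [T]. *)
Definition ker_perp (T : X -> Y) : set (X -> R^o) :=
  [set xi | dual_space X xi /\ forall x, T x = 0 -> xi x = 0].

Local Open Scope ereal_scope.

Definition gn_functional (F : X -> Y) (dF : X -> X -> Y) (ThetaF : X -> \bar R)
    (xi0 : X -> R^o) (x0 : X) (a : R) (yd : Y) (xn : X) : X -> \bar R :=
  fun x => (`|yd - F xn - dF xn (x - xn)| ^+ 2)%:E + a%:E * bregman ThetaF xi0 x x0.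

(* [x 0, ..., x N] are the first iterates for the data [yd]; [x n] is
   irrelevant for [n > N]. *)
Definition gn_iterates (F : X -> Y) (dF : X -> X -> Y) (ThetaF : X -> \bar R)
    (xi0 : X -> R^o) (x0 : X) (alpha : nat -> R) (yd : Y)
    (x : nat -> X) (N : nat) : Prop :=
  x 0%N = x0 /\
  forall n, (n < N)%N ->
    unique_minimizer (gn_functional F dF ThetaF xi0 x0 (alpha n) yd (x n)) (x n.+1).

End Operator.

Definition scaling_sequence (R : realType) (alpha : nat -> R) (theta : R) : Prop :=
  [/\ forall n, 0 < alpha n,
      forall n, 1 <= alpha n / alpha n.+1 <= theta
    & alpha n @[n --> \oo] --> 0].

Variant stopping_rule := Rule1 | Rule2 | Rule3.

(* [stops_at r c res n]: with residuals [res k = |F (x k) - yd|] and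
   [c = tau * delta], rule [r] returns the index [n]. *)
Definition stops_at (R : realType) (r : stopping_rule) (c : R)
    (res : nat -> R) (n : nat) : Prop :=
  match r with
  | Rule1 => res n <= c /\ forall m, (m < n)%N -> c < res m
  | Rule2 =>
      let crit m := 2^-1 * (res m + res m.-1) <= c in
      (res 0%N <= c /\ n = 0%N) \/
      (c < res 0%N /\
       [/\ (1 <= n)%N, crit n & forall m, (1 <= m < n)%N -> ~ crit m])
  | Rule3 =>
      let crit m := Num.max (res m) (res m.-1) <= c in
      (res 0%N <= c /\ n = 0%N) \/
      (c < res 0%N /\
       [/\ (2 <= n)%N, crit n & forall m, (2 <= m < n)%N -> ~ crit m])
  end.

(* Main.v *)
Require Import Defs.
From mathcomp Require Import all_boot all_order all_algebra.
From mathcomp Require Import all_classical all_reals all_analysis.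
From mathcomp Require Import ring lra.

Set Implicit Arguments.
Unset Strict Implicit.
Unset Printing Implicit Defensive.

Import Order.TTheory GRing.Theory Num.Theory.
Import numFieldNormedType.Exports.

Local Open Scope classical_set_scope.
Local Open Scope ring_scope.

(** Write [e = xi0 - xidag], [e_n = x_n - xdag], [T] for the derivative at [xdag],
    [K = K0 + K1], [sigma_n] for the square root of [alpha_n], and let [M] bound
    the norm of [e].

    Since [Y] is a Hilbert space and [Theta] is 2-convex with some modulus [c],
    comparing the minimizer [x_(n+1)] with [xdag] gives the energy inequality
    [step_energy]
      |r_n|^2 + |F'(x_n) e_(n+1)|^2 + alpha_n c |e_(n+1)|^2
        <= |s_n|^2 + alpha_n e(e_(n+1)),
    where [r_n] and [s_n] are the values of the linearized residual at [x_(n+1)]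
    and at [xdag]. The nonlinearity condition implies the tangential cone
    condition ([tangential_cone]), hence [|s_n| <= delta + small * |T e_n|]. The
    factor one in front of [delta] is what makes every [tau > 1] admissible.

    As long as [delta] is at most a fixed multiple of [M sigma_n], induction gives
    [|e_n| <= C1 M] and [|T e_n| <= C2 M sigma_n] ([good_step]). Once [delta] is
    larger, the residuals are at most [tau delta] ([residual_stop]); this happens
    at two consecutive indices, so each of the three rules stops ([stop_bound]).

    For the convergence, reflexivity and [e] in the annihilator of the kernel of
    [T] give, for every [eps > 0], a bound [|e(v)| <= eps |v| + A |T v|]
    ([kernel_annihilator_bound]), so that [e(e_n)] tends to [0] uniformly in the
    data. Before the iteration stops, one of two consecutive residuals exceeds
    [tau delta]; with the energy inequality this makes both [|T e_n| / sigma_n]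
    and [delta / sigma_n] small for large [n], uniformly in the data
    ([active_small]), and one more step makes [e_n] small ([active_cvg]). This
    settles large stopping indices. For a fixed stopping index [n] and [K > 0] the
    iterates depend continuously on the data ([run_stability]); the residual at
    the stopping index is at most [2 tau delta], so the exact iterate solves
    [F x = y] and equals [xdag] by uniqueness ([nonlinear_fixed_cvg]). For [K = 0]
    the derivative is constant on the ball, [T e_n] is of order [delta], and the
    energy inequality concludes directly ([linear_fixed_cvg]). *)

(** * Bounded linear maps and inner products *)

Section LinearMaps.
Context {R : realType} {V W : normedModType R}.
Variable f : V -> W.
Hypothesis fbl : bounded_linear f.

Lemma bounded_linear0 : f 0 = 0.
Proof.
have [lf _] := fbl.
have := lf 1 0 0; rewrite !scale1r addr0 => /(congr1 (fun z => z - f 0)).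
by rewrite addrK subrr => <-.
Qed.

Lemma bounded_linearD u v : f (u + v) = f u + f v.
Proof. by have [lf _] := fbl; rewrite -[u in LHS]scale1r lf scale1r. Qed.

Lemma bounded_linearZ a u : f (a *: u) = a *: f u.
Proof. by have [lf _] := fbl; rewrite -[X in f X]addr0 lf bounded_linear0 addr0. Qed.

Lemma bounded_linearN u : f (- u) = - f u.
Proof. by rewrite -scaleN1r bounded_linearZ scaleN1r. Qed.

Lemma bounded_linearB u v : f (u - v) = f u - f v.
Proof. by rewrite bounded_linearD bounded_linearN. Qed.

Lemma opnorm_has_sup :
  has_sup [set `|f x| | x in [set x : V | `|x| <= 1]].
Proof.
have [lf cf] := fbl.
split; first by exists `|f 0|, 0 => //=; rewrite normr0 ler01.
have /cvgrPdist_lt/(_ 1 ltr01) := cf 0.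
rewrite bounded_linear0 => /nbhs_ballP[d /= d0 fd].
exists (2 / d) => _ [x /= x1 <-].
have : ball (0 : V) d ((d / 2) *: x).
  rewrite -ball_normE /= sub0r normrN normrZ gtr0_norm; last by rewrite divr_gt0.
  rewrite (@le_lt_trans _ _ (d / 2)) //; last by rewrite ltr_pdivrMr// ltr_pMr// ltr1n.
  by rewrite ler_piMr// divr_ge0// ltW.
move/fd; rewrite sub0r normrN bounded_linearZ normrZ gtr0_norm; last by rewrite divr_gt0.
move=> h; rewrite ler_pdivlMr// mulrC -ler_pdivlMl //; apply: ltW.
by move: h; rewrite mulrAC ltr_pdivrMr// mul1r -ltr_pdivlMl.
Qed.

Lemma opnorm_ge0 : 0 <= opnorm f.
Proof.
apply: (@le_trans _ _ `|f 0|) => //; apply: ub_le_sup.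
  by have [] := opnorm_has_sup.
by exists 0 => //=; rewrite normr0 ler01.
Qed.

Lemma le_opnorm x : `|f x| <= opnorm f * `|x|.
Proof.
have [->|x0] := eqVneq x 0; first by rewrite bounded_linear0 !normr0 mulr0.
have nx : 0 < `|x| by rewrite normr_gt0.
rewrite -ler_pdivrMr//.
have -> : `|f x| / `|x| = `|f (`|x|^-1 *: x)|.
  by rewrite bounded_linearZ normrZ mulrC gtr0_norm// invr_gt0.
apply: ub_le_sup; first by have [] := opnorm_has_sup.
exists (`|x|^-1 *: x) => //=.
by rewrite normrZ gtr0_norm ?invr_gt0// mulVf// gt_eqF.
Qed.

End LinearMaps.

Section InnerProduct.
Context {R : realType} {Y : normedModType R}.
Variable ip : Y -> Y -> R.
Hypothesis ipC : forall u v, ip u v = ip v u.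
Hypothesis ipP : forall a u v w, ip (a *: u + v) w = a * ip u w + ip v w.
Hypothesis ipN : forall u, ip u u = `|u| ^+ 2.

Lemma ip0l w : ip 0 w = 0.
Proof. by have := ipP (-1) 0 0 w; rewrite scaler0 addr0; lra. Qed.

Lemma ipZl a u w : ip (a *: u) w = a * ip u w.
Proof. by rewrite -[X in ip X _]addr0 ipP ip0l addr0. Qed.

Lemma ipDl u v w : ip (u + v) w = ip u w + ip v w.
Proof. by rewrite -[u in LHS]scale1r ipP mul1r. Qed.

Lemma normsq_comb (a b : R) u v :
  `|a *: u + b *: v| ^+ 2 =
  a ^+ 2 * `|u| ^+ 2 + b ^+ 2 * `|v| ^+ 2 + 2 * (a * b) * ip u v.
Proof.
rewrite -!ipN ipDl !ipZl ![ip _ (_ + _)]ipC !ipDl !ipZl [ip v u]ipC; ring.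
Qed.

Lemma ip_bound u v : `|ip u v| <= `|u| * `|v|.
Proof.
rewrite -ler_sqr ?nnegrE ?mulr_ge0// exprMn real_normK ?num_real//.
have [->|v0] := eqVneq v 0.
  by rewrite ipC ip0l expr0n/= normr0 expr0n/= mulr0.
have vp : 0 < `|v| ^+ 2 by rewrite exprn_gt0// normr_gt0.
have := sqr_ge0 `| `|v| ^+ 2 *: u + (- ip u v) *: v|.
rewrite normsq_comb => h.
rewrite -(ler_pM2l vp) -subr_ge0; apply: le_trans h _.
rewrite le_eqVlt; apply/orP; left; apply/eqP; ring.
Qed.

(** In an inner product space the squared norm is strongly convex, with
    equality in the convexity inequality. *)
Lemma normsq_convex (t : R) (u v : Y) :
  `|t *: u + (1 - t) *: v| ^+ 2 =
  t * `|u| ^+ 2 + (1 - t) * `|v| ^+ 2 - t * (1 - t) * `|u - v| ^+ 2.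
Proof.
have -> : u - v = 1 *: u + (-1) *: v by rewrite scale1r scaleN1r.
rewrite !normsq_comb; ring.
Qed.

End InnerProduct.

(** The mean value inequality for a vector-valued function on the unit interval;
    [d t] is the derivative at [t], one-sided at the end points. *)
Lemma vector_mean_value {R : realType} {Y : normedModType R} (G d : R -> Y) (L : R) :
  (forall t, 0 <= t <= 1 -> `|d t| <= L) ->
  (forall t, 0 <= t <= 1 -> forall e, 0 < e -> exists2 h, 0 < h &
     forall s, 0 <= s <= 1 -> `|s - t| < h ->
       `|G s - G t - (s - t) *: d t| <= e * `|s - t|) ->
  `|G 1 - G 0| <= L.
Proof.
move=> dL dG; apply/ler_addgt0Pr => e e0.
have step t s h : 0 <= t <= 1 -> `|G s - G t - (s - t) *: d t| <= h * `|s - t| ->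
    `|G s - G t| <= (L + h) * `|s - t|.
  move=> t01 hh; rewrite -[X in `|X|](subrK ((s - t) *: d t)).
  rewrite (le_trans (ler_normD _ _))// mulrDl addrC lerD// normrZ mulrC.
  by rewrite ler_wpM2r// dL.
have L0 : 0 <= L by apply: le_trans (dL 0 _) => //; rewrite lexx ler01.
(* the supremum of S belongs to S and cannot be less than 1 *)
pose S := [set t | 0 <= t <= 1 /\ `|G t - G 0| <= (L + e) * t].
have S0 : S 0 by split; rewrite ?lexx ?ler01// subrr normr0 mulr0.
have Sb : has_sup S.
  by split; [exists 0|exists 1 => t [/andP[]]].
pose c := sup S.
have c0 : 0 <= c by apply: ub_le_sup => //; case: Sb.
have c1 : c <= 1 by apply: ge_sup; [exists 0|move=> t [/andP[]]].
have c01 : 0 <= c <= 1 by rewrite c0 c1.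
have [h h0 hG] := dG c c01 e e0.
have Sc : S c.
  split=> //.
  have [s Ss cs] := sup_adherent h0 Sb.
  have sc : s <= c by apply: ub_le_sup => //; case: Sb.
  have [s01 Gs] := Ss.
  have hs : `|s - c| < h by rewrite distrC ger0_norm ?subr_ge0//; move: cs; rewrite -/c; lra.
  have := step _ _ _ c01 (hG _ s01 hs); rewrite distrC [`|s - c|]distrC ger0_norm ?subr_ge0// => Gsc.
  have := ler_distD (G s) (G c) (G 0); move: Gs Gsc; nra.
have [c1'|c1'] := eqVneq c 1.
  by have [_] := Sc; rewrite c1' mulr1.
have cl : c < 1 by rewrite lt_neqAle c1'.
pose s := Num.min 1 (c + h / 2).
have cs : c < s by rewrite lt_min cl/= ltrDl divr_gt0.
have s1 : s <= 1 by rewrite ge_min lexx.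
have sh : s <= c + h / 2 by rewrite ge_min lexx orbT.
have s01 : 0 <= s <= 1 by rewrite s1 andbT; lra.
have hs : `|s - c| < h by rewrite ger0_norm; lra.
have := step _ _ _ c01 (hG _ s01 hs); rewrite ger0_norm ?subr_ge0 ?(ltW cs)// => Gsc.
have Ss : S s.
  by split=> //; have [_] := Sc; have := ler_distD (G c) (G s) (G 0); nra.
have : s <= c by apply: ub_le_sup => //; case: Sb.
by rewrite leNgt cs.
Qed.

(** * Strongly convex minimization *)

Section StrongConvexity.
Context {R : realType} {X : normedModType R}.
Implicit Types (D : set X) (f g : X -> R).

(** The convex set [D] carries a real function that is strongly convex with
    modulus [c]. *)
Definition strongly_convex D (c : R) g : Prop :=
  forall u z (t : R), D u -> D z -> 0 < t < 1 ->
    D (t *: z + (1 - t) *: u) /\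
    g (t *: z + (1 - t) *: u) <=
      t * g z + (1 - t) * g u - c * t * (1 - t) * `|z - u| ^+ 2.

(** [u] minimizes [f] over [D]. *)
Definition minimizes D f u : Prop := D u /\ forall z, D z -> f u <= f z.

(** Lower semicontinuity of [g] on a set [D], the value outside [D] being
    understood as infinite. *)
Definition closed_sublevels D g : Prop :=
  forall B, closed [set u | D u /\ g u <= B].

(** The convexity inequality with modulus [P] along the segment from a minimizer
    [u] to [z], divided by [t] and taken in the limit [t -> 0]. *)
Lemma minimizer_gap D f u z P :
  (forall t : R, 0 < t < 1 -> D (t *: z + (1 - t) *: u) /\
    f (t *: z + (1 - t) *: u) <= t * f z + (1 - t) * f u - t * (1 - t) * P) ->
  minimizes D f u -> f u + P <= f z.
Proof.
move=> fc [Du umin].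
have h t : 0 < t < 1 -> (1 - t) * P <= f z - f u.
  move=> t01; have [Dt ft] := fc t t01; have ut := umin _ Dt.
  move: t01 => /andP[t0 t1].
  by rewrite -(ler_pM2l t0); lra.
rewrite -lerBrDl; apply/ler_addgt0Pr => e e0.
have [P0|P0] := leP P 0.
  by have := h (1/2) ltac:(lra); nra.
pose t := Num.min (1/2) (e / P).
have t0 : 0 < t by rewrite lt_min (divr_gt0 e0 P0) andbT; lra.
have t1 : t <= 1/2 by rewrite ge_min lexx.
have tP : t * P <= e by rewrite -ler_pdivlMr// ge_min lexx orbT.
by have := h t ltac:(lra); lra.
Qed.

Lemma strongly_convex_gap D c f u z :
  strongly_convex D c f -> minimizes D f u -> D z ->
  f u + c * `|z - u| ^+ 2 <= f z.
Proof.
move=> fc um Dz; apply: (minimizer_gap (D := D)) => // t t01.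
have [Dt ft] := fc u z t um.1 Dz t01; split=> //.
by rewrite (le_trans ft)// le_eqVlt; apply/orP; left; apply/eqP; ring.
Qed.

(** Perturbing by a linear functional preserves the modulus. *)
Lemma strongly_convex_tilt D c g (xi : X -> R^o) :
  bounded_linear xi -> strongly_convex D c g ->
  strongly_convex D c (fun u => g u - xi u).
Proof.
move=> xil gc u z t Du Dz t01; have [Dt gt] := gc u z t Du Dz t01; split=> //.
rewrite (bounded_linearD xil) !(bounded_linearZ xil) /GRing.scale/=.
by move: gt; lra.
Qed.

Lemma closed_sublevelsP D g :
  closed_sublevels D g <->
  forall w B, (forall e, 0 < e -> exists u, [/\ D u, `|w - u| < e & g u <= B]) ->
    D w /\ g w <= B.
Proof.
split=> [cl w B h|h B w cw].
  apply: (cl B w) => V /nbhs_ballP[e /= e0 eV].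
  have [u [Du wu gu]] := h e e0.
  by exists u; split=> //; apply: eV; rewrite -ball_normE.
apply: h => e e0.
have [u [[Du gu]]] := cw (ball w e) (nbhsx_ballx _ _ e0).
by rewrite -ball_normE /= => wu; exists u.
Qed.

Lemma closed_sublevels_add D g q a :
  0 < a -> continuous q -> closed_sublevels D g ->
  closed_sublevels D (fun u => q u + a * g u).
Proof.
move=> a0 qc /closed_sublevelsP gc; apply/closed_sublevelsP => w B h.
have key e : 0 < e -> D w /\ g w <= (B - q w + e) / a.
  move=> e0; apply: gc => e' e'0.
  have /cvgrPdist_lt/(_ e e0)/nbhs_ballP[d /= d0 qd] := qc w.
  have [|u [Du wu gu]] := h (Num.min e' d); first by rewrite lt_min e'0.
  move: wu; rewrite lt_min => /andP[we' wd]; exists u; split=> //.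
  rewrite ler_pdivlMr// mulrC.
  have := qd u; rewrite -ball_normE /= => /(_ wd); rewrite ltr_norml => /andP[_].
  by lra.
have [Dw _] := key 1 ltr01; split=> //; apply/ler_addgt0Pr => e e0.
by have [_] := key e e0; rewrite ler_pdivlMr//; lra.
Qed.

End StrongConvexity.

Lemma closed_sublevels_tilt {R : realType} {X : normedModType R} (D : set X)
    (g : X -> R) (xi : X -> R^o) :
  bounded_linear xi -> closed_sublevels D g ->
  closed_sublevels D (fun u => g u - (xi u : R)).
Proof.
move=> xil gc.
rewrite (_ : (fun u => _) = (fun u => - (xi u : R) + 1 * g u)); last first.
  by apply/funext => u; rewrite mul1r addrC.
apply: closed_sublevels_add => // u; apply: (@continuousN _ R^o); exact: xil.2.
Qed.

(** A minimizing sequence of a strongly convex function is a Cauchy sequence,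
    so that neither compactness nor reflexivity is needed. *)
Lemma exists_minimizer {R : realType} {X : completeNormedModType R} (D : set X)
    (c : R) (f : X -> R) :
  0 < c -> strongly_convex D c f -> closed_sublevels D f -> D !=set0 ->
  (exists m, forall u, D u -> m <= f u) -> exists u, minimizes D f u.
Proof.
move=> c0 fc fcl [d0 Dd0] [m fm].
pose S := [set f u | u in D].
have Sinf : has_inf S.
  by split; [exists (f d0), d0|exists m => _ [u Du <-]; exact: fm].
pose I := inf S.
have IS u : D u -> I <= f u by move=> Du; apply: ge_inf; [case: Sinf|exists u].
have /choice[u uP] (k : nat) : exists u, D u /\ f u < I + k.+1%:R^-1.
  have k0 : 0 < k.+1%:R^-1 :> R by rewrite invr_gt0.
  by have [_ [u Du <-] uk] := inf_adherent k0 Sinf; exists u.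
have ucl k l : (k <= l)%N -> `|u l - u k| ^+ 2 <= 4 / c * k.+1%:R^-1.
  move=> kl; have [Dk fk] := uP k; have [Dl fl] := uP l.
  have [Dm] := fc _ _ (1/2) Dk Dl ltac:(lra).
  have := IS _ Dm.
  have : l.+1%:R^-1 <= k.+1%:R^-1 :> R by rewrite lef_pV2 ?posrE// ler_nat.
  set a := l.+1%:R^-1 in fl *; set b := k.+1%:R^-1 in fk *.
  move=> ab h1 h2.
  rewrite mulrAC ler_pdivlMr//; move: h1 h2 fk fl ab.
  set n := `|_| ^+ 2; set F := f (_ + _); move: (f (u l)) (f (u k)) => p q.
  by nra.
have ucauchy : cauchy (u @ \oo).
  apply: cauchy_exP => e /= e0.
  have [k ke] : exists k : nat, 4 / c * k.+1%:R^-1 < e ^+ 2.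
    exists (Num.truncn (4 / c / e ^+ 2)).
    rewrite ltr_pdivrMr// [ltRHS]mulrC -ltr_pdivrMr ?exprn_gt0//.
    by rewrite truncnS_gt.
  exists (u k); exists k => // l /= kl; rewrite -ball_normE /= distrC.
  rewrite -(ltr_pXn2r (n := 2)) ?nnegrE// ?ltW//.
  exact: le_lt_trans (ucl _ _ kl) ke.
have ucvg : cvg (u @ \oo) by apply: cauchy_cvg.
have wP e : 0 < e -> D (lim (u @ \oo)) /\ f (lim (u @ \oo)) <= I + e.
  move=> e0; apply: (closed_cvg (fun x => D x /\ f x <= I + e)) ucvg; first exact: fcl.
  exists (Num.truncn e^-1) => // k /= ke; have [Dk fk] := uP k; split=> //.
  rewrite (le_trans (ltW fk))// lerD2l -[leRHS]invrK lef_pV2 ?posrE ?invr_gt0//.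
  apply/ltW; apply: lt_le_trans (truncnS_gt _) _; by rewrite ler_nat.
exists (lim (u @ \oo)); split; first by case: (wP 1 ltr01).
move=> z Dz; apply: le_trans (IS _ Dz); apply/ler_addgt0Pr => e e0.
by case: (wP e e0).
Qed.

Lemma convex_combB {R : realType} {V : lmodType R} (t : R) (u v w : V) :
  t *: u + (1 - t) *: v - w = t *: (u - w) + (1 - t) *: (v - w).
Proof.
by rewrite !scalerBr addrACA -opprD -scalerDl subrKC scale1r.
Qed.

Section Tikhonov.
Context {R : realType} {X : normedModType R} {Y : completeNormedModType R}.
Implicit Types (D : set X) (g : X -> R) (L : X -> Y).

(** The Tikhonov functional of the linear equation [L (w - p) = b] with
    penalty [a * g]. *)
Definition tikhonov (b : Y) L (p : X) (a : R) g (w : X) : R :=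
  `|b - L (w - p)| ^+ 2 + a * g w.

Lemma tikhonov_convex D c g b L p a u z (t : R) :
  hilbert_space Y -> bounded_linear L -> 0 <= a -> strongly_convex D c g ->
  D u -> D z -> 0 < t < 1 ->
    D (t *: z + (1 - t) *: u) /\
    tikhonov b L p a g (t *: z + (1 - t) *: u) <=
      t * tikhonov b L p a g z + (1 - t) * tikhonov b L p a g u
      - t * (1 - t) * (a * c * `|z - u| ^+ 2 + `|L (z - u)| ^+ 2).
Proof.
move=> [ip [ipC ipP ipN]] Ll a0 gc Du Dz t01.
have [Dt gt] := gc u z t Du Dz t01; split=> //; rewrite /tikhonov.
have -> : b - L (t *: z + (1 - t) *: u - p) =
    t *: (b - L (z - p)) + (1 - t) *: (b - L (u - p)).
  rewrite convex_combB (bounded_linearD Ll (t *: _)) !(bounded_linearZ Ll).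
  by rewrite !scalerBr addrACA -scalerDl subrKC scale1r opprD.
rewrite (normsq_convex ipC ipP ipN).
have -> : b - L (z - p) - (b - L (u - p)) = - L (z - u).
  rewrite opprB addrC addrA subrK -(bounded_linearB Ll) -(bounded_linearN Ll).
  by congr L; rewrite !opprB addrA subrK.
rewrite normrN; have := ler_wpM2l a0 gt; lra.
Qed.

(** At a minimizer of the Tikhonov functional the value grows at least like
    the sum of the two quadratic moduli. *)
Lemma tikhonov_gap D c g b L p a u z :
  hilbert_space Y -> bounded_linear L -> 0 <= a -> strongly_convex D c g ->
  minimizes D (tikhonov b L p a g) u -> D z ->
  tikhonov b L p a g u + (a * c * `|z - u| ^+ 2 + `|L (z - u)| ^+ 2)
    <= tikhonov b L p a g z.
Proof.
move=> Yh Ll a0 gc um Dz; apply: (minimizer_gap (D := D)) => // t t01.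
exact: tikhonov_convex Yh Ll a0 gc um.1 Dz t01.
Qed.

End Tikhonov.

Lemma exists_tikhonov_minimizer {R : realType} {X Y : completeNormedModType R}
    (D : set X) (c : R) (g : X -> R) (b : Y) (L : X -> Y) (p : X) (a : R) :
  hilbert_space Y -> bounded_linear L -> 0 < a -> 0 < c ->
  strongly_convex D c g -> closed_sublevels D g -> D !=set0 ->
  (exists m, forall u, D u -> m <= g u) ->
  exists u, minimizes D (tikhonov b L p a g) u.
Proof.
move=> Yh Ll a0 c0 gc gcl D0 [m gm].
apply: (@exists_minimizer _ _ _ (a * c)) => //; first exact: mulr_gt0.
- move=> u z t Du Dz t01.
  have [Dt h] := tikhonov_convex b p Yh Ll (ltW a0) gc Du Dz t01; split=> //.
  apply: (le_trans h); rewrite -mulrA.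
  have : 0 <= t * (1 - t) * `|L (z - u)| ^+ 2 by rewrite !mulr_ge0//; lra.
  lra.
- apply: closed_sublevels_add => // w.
  have Lc : {for w, continuous (fun u => b - L (u - p))}.
    apply: continuousB; first exact: cst_continuous.
    apply: (continuous_comp (f := fun u => u - p)).
      by apply: continuousB => //; exact: cst_continuous.
    exact: Ll.2.
  apply: (continuous_comp (f := fun u => b - L (u - p)) (g := fun v => `|v| ^+ 2)) => //.
  apply: (continuous_comp (f := fun v : Y => `|v|) (g := fun r : R => r ^+ 2)).
    exact: norm_continuous.
  exact: exprn_continuous.
- exists (a * m) => u Du.
  by rewrite /tikhonov -[leLHS]add0r lerD ?sqr_ge0// ler_pM2l// gm.
Qed.

(** * The tangential cone condition and the annihilator of the kernel *)

Lemma convex_set_comb {R : realType} {X : lmodType R} (A : set X) u z (t : R) :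
  convex_set (A : set (convex_lmodType X)) -> A u -> A z -> 0 <= t <= 1 ->
  A (t *: z + (1 - t) *: u).
Proof.
move=> cA Au Az /andP[t0 t1].
have := cA z u (Itv01 t0 t1); rewrite !inE => /(_ Az Au).
by rewrite /conv /=.
Qed.

Section TangentialCone.
Context {R : realType} {X Y : normedModType R}.
Variables (F : X -> Y) (DF : set X) (dF : X -> X -> Y) (xdag : X).
Variables (rho K0 K1 : R).
Hypothesis DF_convex : convex_set (DF : set (convex_lmodType X)).
Hypothesis F_diff : has_directional_derivatives F DF dF xdag rho.
Hypothesis F_nonlin : nonlinearity_condition DF dF xdag rho K0 K1.
Hypotheses (K0_ge0 : 0 <= K0) (K1_ge0 : 0 <= K1).

Let B := ball xdag rho `&` DF.

Lemma segment_in x z (t : R) : B x -> B z -> 0 <= t <= 1 -> B (x + t *: (z - x)).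
Proof.
move=> [xb xD] [zb zD] t01.
have -> : x + t *: (z - x) = t *: z + (1 - t) *: x.
  by rewrite scalerBr scalerBl scale1r addrC -addrA [- _ + _]addrC.
split; last exact: convex_set_comb.
move: xb zb; rewrite -!ball_normE /= distrC [`|_ - z|]distrC => xb zb.
rewrite distrC convex_combB (le_lt_trans (ler_normD _ _))// !normrZ.
move/andP: t01 => [t0 t1]; rewrite !ger0_norm ?subr_ge0//.
have [->|t1'] := eqVneq t 1; first by rewrite mul1r subrr mul0r addr0.
have : t < 1 by rewrite lt_neqAle t1'.
nra.
Qed.

(** The directional derivative as a first order expansion. *)
Lemma directional_approx p q : B p -> B q -> forall e, 0 < e ->
  exists2 h, 0 < h & forall t, 0 < t < h ->
    `|F (p + t *: (q - p)) - F p - t *: dF p (q - p)| <= e * t.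
Proof.
move=> Bp Bq e e0; have [_ /(_ q Bq)/cvgrPdist_le/(_ e e0)] := F_diff Bp.
move=> [h /= h0 hF]; exists h => // t /andP[t0 th].
have := hF t; rewrite /= sub0r normrN gtr0_norm// => /(_ th t0).
rewrite distrC -(ler_pM2l t0) -[X in X * `|_|](gtr0_norm t0) -normrZ scalerBr.
by rewrite scalerA mulfV ?gt_eqF// scale1r mulrC.
Qed.

Lemma segment_right_approx x z (t : R) : B x -> B z -> 0 <= t <= 1 ->
  forall e, 0 < e -> exists2 h, 0 < h & forall s, t < s <= 1 -> s - t < h ->
    `|F (x + s *: (z - x)) - F (x + t *: (z - x))
      - (s - t) *: dF (x + t *: (z - x)) (z - x)| <= e * (s - t).
Proof.
move=> Bx Bz t01 e e0; have Bt := segment_in Bx Bz t01.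
have [t1|t1] := leP 1 t; first by exists 1 => // s; lra.
have ht : 0 < 1 - t by lra.
have zt : z - (x + t *: (z - x)) = (1 - t) *: (z - x).
  by rewrite opprD addrA scalerBl scale1r.
have [h h0 hF] := directional_approx Bt Bz (mulr_gt0 e0 ht).
exists (h * (1 - t)); first exact: mulr_gt0.
move=> s /andP[ts s1] sh.
have := hF ((s - t) / (1 - t)).
rewrite ltr_pdivrMr// sh divr_gt0// ?subr_gt0// => /(_ isT).
have -> : e * (1 - t) * ((s - t) / (1 - t)) = e * (s - t).
  by rewrite -mulrA [_ * (_ / _)]mulrCA mulfV ?gt_eqF// mulr1.
rewrite zt (bounded_linearZ (F_diff Bt).1) !scalerA divfK ?gt_eqF//.
have -> // : x + t *: (z - x) + (s - t) *: (z - x) = x + s *: (z - x).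
by rewrite -addrA -scalerDl subrKC.
Qed.

Lemma segment_left_approx x z (t : R) : B x -> B z -> 0 <= t <= 1 ->
  forall e, 0 < e -> exists2 h, 0 < h & forall s, 0 <= s < t -> t - s < h ->
    `|F (x + s *: (z - x)) - F (x + t *: (z - x))
      - (s - t) *: dF (x + t *: (z - x)) (z - x)| <= e * (t - s).
Proof.
move=> Bx Bz t01 e e0.
have rv (s : R) : z + (1 - s) *: (x - z) = x + s *: (z - x).
  by rewrite scalerBl scale1r addrA subrKC -scalerN opprB.
have [h h0 hF] := @segment_right_approx z x (1 - t) Bz Bx ltac:(lra) e e0.
exists h => // s st sh; have := hF (1 - s) ltac:(lra) ltac:(lra).
have -> : 1 - s - (1 - t) = t - s by lra.
rewrite !rv -[x - z]opprB (bounded_linearN (F_diff (segment_in Bx Bz t01)).1).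
by rewrite scalerN -scaleNr opprB.
Qed.

(** The tangential cone condition: the linearization error of [F] is controlled
    by the linearization itself. *)
Lemma tangential_cone x z : B x -> B z ->
  `|F z - F x - dF x (z - x)| <= (K0 + K1) * `|z - x| * `|dF x (z - x)|.
Proof.
move=> Bx Bz; set w := dF x (z - x).
pose p (t : R) := x + t *: (z - x).
have := @vector_mean_value R Y (fun t => F (p t) - t *: w)
  (fun t => dF (p t) (z - x) - w) ((K0 + K1) * `|z - x| * `|w|).
have p0 : p 0 = x by rewrite /p scale0r addr0.
have p1 : p 1 = z by rewrite /p scale1r subrKC.
rewrite p0 p1 scale0r scale1r subr0.
rewrite (_ : F z - w - F x = F z - F x - w); last by rewrite addrAC.
apply.
- move=> t t01; have Bt := segment_in Bx Bz t01.
  have := @F_nonlin (z - x) x (p t) Bx Bt => h; apply: (le_trans h).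
  have -> : p t - x = t *: (z - x) by rewrite /p addrC addKr.
  rewrite (bounded_linearZ (F_diff Bx).1) !normrZ -/w.
  move/andP: t01 => [t0 t1]; rewrite ger0_norm//.
  have P : 0 <= (K0 + K1) * (`|z - x| * `|w|) by rewrite !mulr_ge0 ?addr_ge0.
  have := ler_wpM2r P t1; lra.
- move=> t t01 e e0.
  have [h h0 hR] := segment_right_approx Bx Bz t01 e0.
  have [h' h'0 hL] := segment_left_approx Bx Bz t01 e0.
  exists (Num.min h h'); first by rewrite lt_min h0.
  move=> s /andP[s0 s1]; rewrite lt_min => /andP[sh sh'].
  have -> : F (p s) - s *: w - (F (p t) - t *: w)
      - (s - t) *: (dF (p t) (z - x) - w)
    = F (p s) - F (p t) - (s - t) *: dF (p t) (z - x).
    rewrite (scalerBr (s - t)) (scalerBl s t w) !opprB addrA; congr (_ - _).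
    by rewrite addrAC [X in X + _]addrA subrK addrA subrK.
  have [ts|st|<-] := ltgtP t s; last first.
  - by rewrite !subrr scale0r subr0 !normr0 mulr0.
  - have st' : `|s - t| = t - s by rewrite distrC gtr0_norm ?subr_gt0.
    by rewrite st'; apply: hL; rewrite ?s0 ?st//; lra.
  - have st' : `|s - t| = s - t by rewrite gtr0_norm ?subr_gt0.
    by rewrite st'; apply: hR; rewrite ?s1 ?ts//; lra.
Qed.

End TangentialCone.

(** If no [M] works, there are unit vectors [v k] with [T (v k)] tending to [0] and
    [xi (v k)] bounded away from [0]. Limits of functionals along an ultrafilter
    define an element of the bidual, hence by reflexivity a weak limit [x] of the
    [v k]; then [T x = 0] but [xi x] is not [0]. *)
Lemma kernel_annihilator_bound {R : realType} {X Y : completeNormedModType R}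
    (T : X -> Y) (xi : X -> R^o) :
  reflexive_space X -> hilbert_space Y -> bounded_linear T -> ker_perp T xi ->
  forall e : R, 0 < e -> exists2 M : R, 0 <= M &
    forall x, `|xi x : R| <= e * `|x| + M * `|T x|.
Proof.
move=> Xr [ip [ipC ipP ipN]] Tl [xil xiT] e e0; apply: contrapT => noM.
have /choice[v vP] (k : nat) : exists v : X,
    `|v| = 1 /\ e + k%:R * `|T v| < `|xi v : R|.
  apply: contrapT => nov; apply: noM; exists k%:R => // x.
  rewrite leNgt; apply/negP => xx; apply: nov.
  have x0 : 0 < `|x|.
    rewrite normr_gt0; apply/eqP => x0; move: xx.
    by rewrite x0 (bounded_linear0 xil) (bounded_linear0 Tl) !normr0 !mulr0 addr0 ltxx.
  exists (`|x|^-1 *: x).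
  rewrite (bounded_linearZ xil) (bounded_linearZ Tl) !normrZ gtr0_norm ?invr_gt0//.
  rewrite mulVf ?gt_eqF//; split=> //.
  rewrite -(ltr_pM2l x0) mulrDr [_ * (k%:R * _)]mulrCA !mulVKf ?gt_eqF//.
  by rewrite mulrC.
have [U [UU sU]] := @ultraFilterLemma nat \oo _.
have lims (eta : X -> R^o) : dual_space X eta ->
    exists l : R, eta (v k) @[k --> U] --> (l : R^o).
  move=> etal.
  have bnd k : `[- opnorm eta, opnorm eta]%classic (eta (v k)).
    rewrite /= in_itv/= -ler_norml.
    by have := le_opnorm etal (v k); rewrite (vP k).1 mulr1.
  have [l [_ lc]] := @segment_compact R (- opnorm eta) (opnorm eta)
    (eta (v k) @[k --> U]) _ (filterS (fun k _ => bnd k) filterT).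
  exists l => V Vl.
  have [//|UV] := in_ultra_setVsetC ((eta \o v) @^-1` V) UU.
  by have [z [/=]] := lc (~` V) V UV Vl.
pose phi (eta : X -> R^o) : R := lim (eta (v k) @[k --> U]).
have phiP eta : dual_space X eta -> eta (v k) @[k --> U] --> (phi eta : R^o).
  by move=> /lims[l]; apply: cvgP.
have [] := Xr phi.
- move=> a eta zeta etal zetal; apply: cvg_lim => //.
  apply: cvgD; last exact: phiP.
  by apply: cvgZr; exact: phiP.
- exists 1 => eta etal; rewrite mul1r.
  rewrite ler_norml; apply/andP; split.
    apply: limr_ge; first by apply/cvg_ex; exists (phi eta : R^o); exact: phiP.
    apply: nearW => k; have := le_opnorm etal (v k).
    by rewrite (vP k).1 mulr1 ler_norml => /andP[].
  apply: limr_le; first by apply/cvg_ex; exists (phi eta : R^o); exact: phiP.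
  apply: nearW => k; have := le_opnorm etal (v k).
  by rewrite (vP k).1 mulr1 ler_norml => /andP[].
move=> x xP.
have Tx0 : T x = 0.
  (* the functional z |-> <T z, T x> vanishes in the limit, and at x it equals |T x|^2 *)
  pose eta : X -> R^o := fun z => ip (T z) (T x).
  have ipTc (w : Y) : continuous (fun u => ip u w : R^o).
    move=> u; apply/cvgrPdist_lt => d d0.
    apply/nbhs_ballP; exists (d / (`|w| + 1)); first by rewrite /= divr_gt0// ltr_wpDl.
    move=> u' /=; rewrite -ball_normE /= ltr_pdivlMr ?ltr_wpDl// => uu'.
    have -> : ip u w - ip u' w = ip (u - u') w.
      by rewrite (ipDl ipP) -[- u']scaleN1r (ipZl ipP) mulN1r.
    rewrite (le_lt_trans (ip_bound ipC ipP ipN _ _))//.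
    by apply: le_lt_trans uu'; rewrite ler_wpM2l// lerDl.
  have etal : dual_space X eta.
    split; first by move=> a z z'; rewrite /eta Tl.1 ipP.
    move=> z; apply: (@continuous_comp _ _ _ T (fun u => ip u (T x) : R^o)).
      exact: Tl.2.
    exact: ipTc.
  suff /eqP : phi eta = 0.
    by rewrite (xP _ etal) /eta ipN sqrf_eq0 normr_eq0 => /eqP.
  apply: cvg_lim => //; apply: cvg_trans (_ : eta (v k) @[k --> \oo] --> (0 : R^o)).
    by move=> V /= [N NN NV]; apply: sU; exists N.
  apply/cvgrPdist_lt => d d0.
  pose C := opnorm xi * `|T x| / d.
  exists (Num.truncn C).+1 => // k /= Ck; rewrite sub0r normrN.
  have kC : C < k%:R by apply: lt_le_trans (truncnS_gt _) _; rewrite ler_nat.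
  have [_ vk] := vP k; have := le_opnorm xil (v k); rewrite (vP k).1 mulr1 => xk.
  have := ip_bound ipC ipP ipN (T (v k)) (T x); rewrite -/(eta _) => h.
  apply: (le_lt_trans h).
  have k0 : 0 < k%:R :> R by rewrite ltr0n (leq_trans _ Ck).
  rewrite -(ltr_pM2l k0) mulrA.
  move: kC; rewrite /C ltr_pdivrMr// => kC.
  apply: le_lt_trans kC; rewrite ler_wpM2r//.
  by move: vk xk e0; lra.
have xiv0 : xi (v k) @[k --> U] --> (0 : R^o).
  by rewrite -(xiT _ Tx0) -(xP _ xil); exact: phiP.
have [k] : exists k, `|0 - xi (v k) : R^o| < e.
  by apply: (@filter_ex _ U); move/cvgrPdist_lt : xiv0; exact.
have [_ vk] := vP k; have Tk : 0 <= k%:R * `|T (v k)| by rewrite mulr_ge0.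
rewrite sub0r normrN; move: vk Tk => /=; lra.
Qed.

(** * Stopping rules *)

Section StoppingRules.
Context {R : realType}.
Variables (r : stopping_rule) (c : R) (res : nat -> R).

(** A rule does not return two different indices. *)
Lemma stops_at_first m n : stops_at r c res n -> (m < n)%N -> ~ stops_at r c res m.
Proof.
case: r => /=.
- by move=> [_ lt_n] mn [res_m _]; have := lt_n m mn; rewrite ltNge res_m.
- move=> [[_ ->//]|[c0 [n1 _ no]]] mn [[r0 _]|[_ [m1 crit_m _]]].
    by move: c0; rewrite ltNge r0.
  by apply: (no m); rewrite ?m1.
- move=> [[_ ->//]|[c0 [n1 _ no]]] mn [[r0 _]|[_ [m1 crit_m _]]].
    by move: c0; rewrite ltNge r0.
  by apply: (no m); rewrite ?m1.
Qed.

Lemma stops_at0 : res 0%N <= c -> stops_at r c res 0.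
Proof. by case: r => /= h; [split|left|left]. Qed.

(** Two consecutive residuals below the threshold suffice for every rule. *)
Lemma stops_at_exists N : (0 < N)%N -> res N <= c -> res N.+1 <= c ->
  exists2 n, (n <= N.+1)%N & stops_at r c res n.
Proof.
move=> N0 rN rN1.
have [r0|r0] := leP (res 0%N) c; first by exists 0%N => //; exact: stops_at0.
have first_index (P : pred nat) : P N.+1 -> exists n, [/\ (n <= N.+1)%N, P n
    & forall m, (m < n)%N -> ~~ P m].
  move=> PN; have exP : exists n, P n by exists N.+1.
  exists (ex_minn exP); case: ex_minnP => n Pn nmin; split=> //; first exact: nmin.
  by move=> m; apply: contraL => /nmin; rewrite -leqNgt.
case: r => /=.
- have [n [nN rn no]] := first_index (fun n => res n <= c) rN1.
  by exists n => //; split=> // m /no; rewrite -ltNge.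
- pose P n := (0 < n)%N && (2^-1 * (res n + res n.-1) <= c).
  have [|n [nN /andP[n0 Pn] no]] := first_index P.
    by rewrite /P /=; move: rN rN1; lra.
  exists n => //; right; split=> //; split=> // m /andP[m0 mn] Pm.
  by have := no m mn; rewrite /P m0 Pm.
- pose P n := (1 < n)%N && (Num.max (res n) (res n.-1) <= c).
  have [|n [nN /andP[n0 Pn] no]] := first_index P.
    by rewrite /P /= ltnS N0 ge_max rN1 rN.
  exists n => //; right; split=> //; split=> // m /andP[m0 mn] Pm.
  by have := no m mn; rewrite /P m0 Pm.
Qed.

Lemma stops_at_residual n : (forall k, 0 <= res k) -> stops_at r c res n ->
  res n <= 2 * c.
Proof.
move=> res0; case: r => /=.
- by move=> [rn _]; have := res0 n; lra.
- by move=> [[r0 ->]|[_ [_ h _]]]; have := res0 n.-1; have := res0 0%N; lra.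
- move=> [[r0 ->]|[_ [_ + _]]]; first by have := res0 0%N; lra.
  by rewrite ge_max => /andP[h _]; have := res0 n; lra.
Qed.

(** From index 2 on, an index before the stopping index has, together with its
    predecessor, at least one residual above the threshold. *)
Lemma stops_at_active m n : stops_at r c res n -> (2 <= m < n)%N ->
  c < Num.max (res m) (res m.-1).
Proof.
case: r => /= + /andP[m2 mn].
- by move=> [_ /(_ m mn)]; rewrite lt_max => ->.
- move=> [[_ n0]|[_ [_ _ no]]]; first by rewrite n0 in mn.
  rewrite ltNge; apply/negP; rewrite ge_max => /andP[h1 h2].
  by apply: (no m); [rewrite mn andbT ltnW|lra].
- move=> [[_ n0]|[_ [_ _ no]]]; first by rewrite n0 in mn.
  by rewrite ltNge; apply/negP => h; apply: (no m); rewrite ?m2.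
Qed.

End StoppingRules.

(** * One step of the Gauss-Newton iteration *)

Lemma le_of_sqr {R : realType} (a b : R) : 0 <= b -> a ^+ 2 <= b ^+ 2 -> a <= b.
Proof. by move=> b0 ab; rewrite leNgt; apply/negP => ba; nra. Qed.

Section GaussNewton.
Context {R : realType} {X Y : completeNormedModType R}.
Variables (F : X -> Y) (DF D : set X) (dF : X -> X -> Y) (xdag : X).
Variables (rho K0 K1 c s tau : R) (sigma : nat -> R).
Variables (g : X -> R) (e : X -> R^o) (x0 : X) (M : R).
Variables (g1 Q C1 C2 nu : R).

Let y := F xdag.
Let T := dF xdag.
Let B := ball xdag rho `&` DF.

(** The data of the iteration. [D] is the effective domain of the restricted
    penalty, [g] is the penalty minus the functional [xi0], real-valued and strongly
    convex on [D] with modulus [c], and [e] is [xi0 - xidag]; then [gn_subgrad] says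
    that [xidag] is a subgradient at [xdag]. The square roots of the regularization
    parameters are the [sigma n], and [s] bounds their consecutive ratios. *)
Record gn_setting : Prop := GNSetting {
  gn_hilbert : hilbert_space Y;
  gn_convex : convex_set (DF : set (convex_lmodType X));
  gn_diff : has_directional_derivatives F DF dF xdag rho;
  gn_nonlin : nonlinearity_condition DF dF xdag rho K0 K1;
  gn_K0 : 0 <= K0;
  gn_K1 : 0 <= K1;
  gn_rho : 0 < rho;
  gn_c : 0 < c;
  gn_s : 1 <= s;
  gn_sub : D `<=` DF;
  gn_dag : D xdag;
  gn_strong : strongly_convex D c g;
  gn_closed : closed_sublevels D g;
  gn_subgrad : forall z, D z -> 0 <= g z - g xdag + e (z - xdag);
  gn_x0 : minimizes D g x0;
  gn_sigma : forall n, 0 < sigma n;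
  gn_sigma_noninc : forall n, sigma n.+1 <= sigma n;
  gn_sigma_ratio : forall n, sigma n <= s * sigma n.+1;
  gn_sigma_cvg : sigma n @[n --> \oo] --> (0 : R);
  gn_tau : 1 < tau;
  gn_M : 0 < M;
  gn_e : forall v, `|e v : R| <= M * `|v|;
  gn_kernel : forall eps, 0 < eps -> exists2 A : R, 0 <= A &
    forall v, `|e v : R| <= eps * `|v| + A * `|T v|
}.

(** Compatible constants. [C1 * M] and [C2 * M * sigma n] bound the error of
    the iterate [n] and its image under [T]; [Q * M * sigma n] bounds the image of
    the next error under the derivative at the iterate [n]. The noise level is compared with
    [g1 * M * sigma n]. The quantity [nu] bounds the nonlinearity [K0 + K1] times
    the radius [C1 * M], by the smallness condition [gc_small]. *)
Record gn_constants : Prop := GNConstants {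
  gc_g1 : 1 <= g1;
  gc_Q0 : 0 < Q;
  gc_Q : 2 * (s * g1 + 1) ^+ 2 + c^-1 <= Q ^+ 2;
  gc_C1 : Q ^+ 2 <= c * C1 ^+ 2;
  gc_C10 : 1 <= c * C1;
  gc_C1g : 4 * s ^+ 2 * C1 <= (tau - 1) ^+ 2 * g1 ^+ 2;
  gc_g1T : 2 * opnorm T <= c * sigma 0 * (tau - 1) * g1;
  gc_C2 : s * (2 * Q + 1) <= C2;
  gc_C2T : opnorm T <= c * sigma 0 * C2;
  gc_nu0 : 0 < nu;
  gc_nu4 : nu <= 1 / 4;
  gc_nuC2 : 2 * nu * C2 <= 1;
  gc_nuC2s : 16 * nu * C2 * s <= tau - 1;
  gc_nus : 8 * s ^+ 2 * nu * (32 + 6 * (tau - 1)) <= tau - 1;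
  gc_small : (K0 + K1) * (C1 * M) <= nu
}.

(** [x'] minimizes the functional of step [n] at the base point [x]. The Bregman
    distance is replaced by [g], which differs from it by a constant on [D]. *)
Definition gn_step (yd : Y) (n : nat) (x x' : X) : Prop :=
  minimizes D (tikhonov (yd - F x) (dF x) x (sigma n ^+ 2) g) x'.

(** [x 0, ..., x N] are the first iterates for the data [yd], and they all lie in
    the ball. *)
Definition gn_run (yd : Y) (x : nat -> X) (N : nat) : Prop :=
  [/\ x 0%N = x0, forall n, (n < N)%N -> gn_step yd n (x n) (x n.+1)
    & forall n, (n <= N)%N -> ball xdag rho (x n)].

(** The bounds that are propagated by induction on the step number [n]. *)
Definition good (n : nat) (x : X) : Prop :=
  [/\ D x, `|x - xdag| <= C1 * M & `|T (x - xdag)| <= C2 * M * sigma n].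

Hypotheses (S : gn_setting) (Co : gn_constants).

Let hb : hilbert_space Y. Proof. exact: gn_hilbert S. Qed.
Let K0_ge0 : 0 <= K0. Proof. exact: gn_K0 S. Qed.
Let K1_ge0 : 0 <= K1. Proof. exact: gn_K1 S. Qed.
Let c_gt0 : 0 < c. Proof. exact: gn_c S. Qed.
Let M_gt0 : 0 < M. Proof. exact: gn_M S. Qed.
Let s_ge1 : 1 <= s. Proof. exact: gn_s S. Qed.
Let Q_gt0 : 0 < Q. Proof. exact: gc_Q0 Co. Qed.
Let nu_gt0 : 0 < nu. Proof. exact: gc_nu0 Co. Qed.
Let nu_le4 : nu <= 1 / 4. Proof. exact: gc_nu4 Co. Qed.

Lemma C1_gt0 : 0 < C1.
Proof.
rewrite -(pmulr_rgt0 _ c_gt0); exact: lt_le_trans (gc_C10 Co).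
Qed.

Lemma C2_ge : 2 * Q + 1 <= C2.
Proof. by apply: le_trans (gc_C2 Co); rewrite ler_peMl// addr_ge0 ?mulr_ge0// ltW. Qed.

Lemma xdag_in_domain : B xdag.
Proof. by split; [exact: ballxx (gn_rho S)|exact: gn_sub (gn_dag S)]. Qed.

Lemma T_linear : bounded_linear T.
Proof. exact: (gn_diff S xdag_in_domain).1. Qed.

Let cone := tangential_cone (gn_convex S) (gn_diff S) (gn_nonlin S) K0_ge0 K1_ge0.

(** Estimates at a base point [x] in the ball, where [(K0 + K1) * |x - xdag|] is at
    most [nu]. *)
Section Base.
Variable x : X.
Hypotheses (Bx : B x) (x_small : `|x - xdag| <= C1 * M).

Lemma base_linear : bounded_linear (dF x).
Proof. exact: (gn_diff S Bx).1. Qed.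

Lemma K_small : (K0 + K1) * `|x - xdag| <= nu.
Proof.
by apply: le_trans (gc_small Co); rewrite ler_wpM2l ?addr_ge0.
Qed.

Lemma residual_T : `|F x - y - T (x - xdag)| <= nu * `|T (x - xdag)|.
Proof.
by apply: (le_trans (cone xdag_in_domain Bx)); rewrite ler_wpM2r// K_small.
Qed.

Lemma residual_le : `|F x - y| <= 2 * `|T (x - xdag)|.
Proof.
have := lerB_dist (F x - y) (T (x - xdag)); have := residual_T.
have := ler_wpM2r (normr_ge0 (T (x - xdag))) nu_le4.
have := normr_ge0 (T (x - xdag)); lra.
Qed.

Lemma T_le_residual : `|T (x - xdag)| <= 2 * `|F x - y|.
Proof.
have := lerB_dist (T (x - xdag)) (F x - y); rewrite [`|T _ - _|]distrC.
have := residual_T; have := ler_wpM2r (normr_ge0 (T (x - xdag))) nu_le4.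
have := normr_ge0 (T (x - xdag)); lra.
Qed.

Lemma base_deriv_le : `|dF x (x - xdag)| <= 2 * `|T (x - xdag)|.
Proof.
have := gn_nonlin S (x - xdag) xdag_in_domain Bx; rewrite -/T => h.
have := lerB_dist (dF x (x - xdag)) (T (x - xdag)).
have := ler_wpM2r (normr_ge0 (T (x - xdag))) K_small.
have := ler_wpM2r (normr_ge0 (T (x - xdag))) nu_le4.
have := normr_ge0 (T (x - xdag)); lra.
Qed.

Lemma base_deriv_opp : `|dF x (xdag - x)| = `|dF x (x - xdag)|.
Proof. by rewrite -opprB (bounded_linearN base_linear) normrN. Qed.

(** The linearized residual at [xdag]; the factor of [delta] is one. *)
Lemma linearization_le yd delta : `|yd - y| <= delta ->
  `|yd - F x - dF x (xdag - x)| <= delta + 2 * nu * `|T (x - xdag)|.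
Proof.
move=> ydd.
have -> : yd - F x - dF x (xdag - x) =
    (yd - y) + (F xdag - F x - dF x (xdag - x)).
  by rewrite !addrA /y subrK.
rewrite (le_trans (ler_normD _ _))// lerD//.
have := cone Bx xdag_in_domain; rewrite base_deriv_opp [`|xdag - x|]distrC.
have := ler_wpM2r (normr_ge0 (dF x (x - xdag))) K_small.
have := ler_wpM2l (ltW nu_gt0) base_deriv_le; lra.
Qed.

Lemma T_le_base v :
  `|T v| <= (1 + nu) * `|dF x v| + 2 * K1 * `|T (x - xdag)| * `|v|.
Proof.
have := gn_nonlin S v Bx xdag_in_domain; rewrite -/T base_deriv_opp [`|xdag - x|]distrC.
have := lerB_dist (T v) (dF x v).
have Kx : K0 * `|x - xdag| <= nu.
  by apply: le_trans K_small; rewrite ler_wpM2r// lerDl.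
have := ler_wpM2r (normr_ge0 (dF x v)) Kx.
have := ler_wpM2r (normr_ge0 v) (ler_wpM2l K1_ge0 base_deriv_le).
lra.
Qed.

(** The residual at a next iterate, up to the linearization error. *)
Lemma residual_next_le yd x' : B x' -> `|x' - xdag| <= C1 * M ->
  `|F x' - yd| <= `|yd - F x - dF x (x' - x)|
     + 2 * nu * (`|dF x (x' - xdag)| + 2 * `|T (x - xdag)|).
Proof.
move=> Bx' x's.
have xx : `|x' - x| <= 2 * (C1 * M).
  rewrite (le_trans (ler_distD xdag x' x))// [`|xdag - x|]distrC; move: x_small x's; lra.
have Axx : `|dF x (x' - x)| <= `|dF x (x' - xdag)| + 2 * `|T (x - xdag)|.
  have -> : x' - x = (x' - xdag) - (x - xdag) by rewrite opprB addrA subrK.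
  rewrite (bounded_linearB base_linear) (le_trans (ler_normB _ _))//.
  by rewrite lerD2l base_deriv_le.
have : `|F x' - yd| <= `|yd - F x - dF x (x' - x)| + `|F x' - F x - dF x (x' - x)|.
  rewrite -[X in X <= _]normrN.
  have -> : - (F x' - yd) = (yd - F x - dF x (x' - x)) - (F x' - F x - dF x (x' - x)).
    by rewrite !opprB addrA subrK addrA subrK.
  exact: ler_normB.
have := cone Bx Bx'.
have KK : (K0 + K1) * `|x' - x| <= 2 * nu.
  have K_ge0 := addr_ge0 K0_ge0 K1_ge0.
  by have := ler_wpM2l K_ge0 xx; have := gc_small Co; lra.
have := ler_wpM2r (normr_ge0 (dF x (x' - x))) KK.
have := ler_wpM2l (ltW nu_gt0) Axx; lra.
Qed.

(** The energy inequality: the gap at the minimizer [x'], compared with [xdag],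
    and the subgradient inequality for [xidag]. *)
Lemma step_energy yd n x' : gn_step yd n x x' ->
  `|yd - F x - dF x (x' - x)| ^+ 2 + `|dF x (x' - xdag)| ^+ 2
    + sigma n ^+ 2 * c * `|x' - xdag| ^+ 2
  <= `|yd - F x - dF x (xdag - x)| ^+ 2 + sigma n ^+ 2 * (e (x' - xdag) : R).
Proof.
move=> st.
have sn : 0 <= sigma n ^+ 2 by rewrite sqr_ge0.
have := tikhonov_gap hb base_linear sn (gn_strong S) st (gn_dag S).
rewrite /tikhonov [`|xdag - x'|]distrC -[xdag - x']opprB (bounded_linearN base_linear) normrN.
have := ler_wpM2l sn (gn_subgrad S st.1).
rewrite mulr0 mulrDr mulrBr; set a := sigma n ^+ 2 * g x'.
set b := sigma n ^+ 2 * g xdag; set d := sigma n ^+ 2 * _.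
lra.
Qed.

End Base.

Lemma e_le v : (e v : R) <= M * `|v|.
Proof. exact: le_trans (ler_norm _) (gn_e S v). Qed.

(** The energy inequality when the contribution of [e] is at most [eta ^+ 2]. *)
Lemma step_energy_bounds x n yd x' delta eta :
  B x -> `|x - xdag| <= C1 * M -> `|yd - y| <= delta -> 0 <= eta ->
  gn_step yd n x x' -> (e (x' - xdag) : R) <= eta ^+ 2 ->
  let E := delta + 2 * nu * `|T (x - xdag)| + sigma n * eta in
  [/\ `|yd - F x - dF x (x' - x)| <= E, `|dF x (x' - xdag)| <= E
    & sigma n ^+ 2 * c * `|x' - xdag| ^+ 2 <= E ^+ 2].
Proof.
move=> Bx xs ydd eta0 st eu E.
have sn := gn_sigma S n.
have d0 : 0 <= delta by apply: le_trans ydd.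
have f0 : 0 <= delta + 2 * nu * `|T (x - xdag)| by rewrite addr_ge0// !mulr_ge0// ltW.
have E0 : 0 <= E by rewrite addr_ge0// mulr_ge0// ltW.
have en := step_energy Bx st.
have s_le : `|yd - F x - dF x (xdag - x)| ^+ 2
    <= (delta + 2 * nu * `|T (x - xdag)|) ^+ 2.
  by rewrite ler_sqr ?nnegrE//; exact: linearization_le.
have se := ler_wpM2l (sqr_ge0 (sigma n)) eu.
have cross : 0 <= (delta + 2 * nu * `|T (x - xdag)|) * (sigma n * eta).
  by rewrite mulr_ge0// mulr_ge0// ltW.
have c2 : 0 <= sigma n ^+ 2 * c * `|x' - xdag| ^+ 2.
  by rewrite !mulr_ge0// ?sqr_ge0// ltW.
have r2 := sqr_ge0 `|yd - F x - dF x (x' - x)|.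
have a2 := sqr_ge0 `|dF x (x' - xdag)|.
have tot : `|yd - F x - dF x (x' - x)| ^+ 2 + `|dF x (x' - xdag)| ^+ 2
    + sigma n ^+ 2 * c * `|x' - xdag| ^+ 2 <= E ^+ 2.
  apply: (le_trans en).
  have -> : E ^+ 2 = (delta + 2 * nu * `|T (x - xdag)|) ^+ 2
      + sigma n ^+ 2 * eta ^+ 2
      + 2 * ((delta + 2 * nu * `|T (x - xdag)|) * (sigma n * eta)).
    by rewrite /E; ring.
  move: s_le se cross; lra.
split; last by move: tot r2 a2; lra.
- by apply: le_of_sqr => //; move: tot c2 a2; lra.
- by apply: le_of_sqr => //; move: tot c2 r2; lra.
Qed.

Lemma K1_small (v : X) : `|v| <= C1 * M -> K1 * `|v| <= nu.
Proof.
move=> vs; apply: le_trans (gc_small Co); apply: ler_pM => //.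
by rewrite lerDr.
Qed.

Lemma T_next_le x x' : B x -> `|x - xdag| <= C1 * M -> `|x' - xdag| <= C1 * M ->
  `|T (x' - xdag)| <= 2 * `|dF x (x' - xdag)| + 2 * nu * `|T (x - xdag)|.
Proof.
move=> Bx xs x's; have := T_le_base Bx xs (x' - xdag).
have := ler_wpM2r (normr_ge0 (T (x - xdag))) (K1_small x's).
have := ler_wpM2r (normr_ge0 (dF x (x' - xdag))) nu_le4.
have := normr_ge0 (dF x (x' - xdag)); lra.
Qed.

Lemma x0_energy : c * `|x0 - xdag| ^+ 2 <= (e (x0 - xdag) : R).
Proof.
have [Dx0 _] := gn_x0 S.
have := strongly_convex_gap (gn_strong S) (gn_x0 S) (gn_dag S).
have := gn_subgrad S Dx0.
rewrite [`|xdag - x0|]distrC; lra.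
Qed.

Lemma x0_dist_le : c * `|x0 - xdag| <= M.
Proof.
have h := le_trans x0_energy (e_le (x0 - xdag)).
have [b0|b0] := eqVneq `|x0 - xdag| 0; first by rewrite b0 mulr0 ltW.
have bp : 0 < `|x0 - xdag| by rewrite lt_neqAle eq_sym b0 normr_ge0.
by rewrite -(ler_pM2r bp) -mulrA -expr2.
Qed.

Lemma good0 : good 0 x0.
Proof.
have [Dx0 _] := gn_x0 S; have b_le := x0_dist_le.
split=> //.
- rewrite -(ler_pM2l c_gt0); apply: (le_trans b_le).
  by rewrite mulrA; apply: ler_peMl; [exact: ltW|exact: gc_C10 Co].
- apply: (le_trans (le_opnorm T_linear _)).
  have := ler_wpM2r (normr_ge0 (x0 - xdag)) (gc_C2T Co).
  have p : 0 <= sigma 0 * C2.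
    rewrite mulr_ge0 ?(ltW (gn_sigma S 0))//.
    by apply: le_trans C2_ge; rewrite addr_ge0// mulr_ge0// ltW.
  have := ler_wpM2l p b_le; lra.
Qed.

(** The bounds propagate as long as the noise level is dominated by [sigma n]. *)
Lemma good_step n x x' yd delta :
  ball xdag rho x -> good n x -> `|yd - y| <= delta ->
  delta <= s * g1 * M * sigma n -> gn_step yd n x x' -> good n.+1 x'.
Proof.
move=> bx [Dx xs xT] ydd dn st.
have Bx : B x by split => //; exact: (gn_sub S).
have sn := gn_sigma S n.
set m := M * sigma n; have m0 : 0 < m by rewrite mulr_gt0.
have en := step_energy Bx st.
have s_le := linearization_le Bx xs ydd.
set b := `|x' - xdag| in en *; set a := `|dF x (x' - xdag)| in en.
set S0 := `|yd - F x - dF x (xdag - x)| in en s_le.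
have S0m : S0 <= (s * g1 + 1) * m.
  apply: (le_trans s_le).
  have := ler_wpM2l (ltW nu_gt0) xT.
  have := ler_wpM2r (ltW m0) (gc_nuC2 Co).
  rewrite /m; move: dn; lra.
have S00 : 0 <= S0 by rewrite normr_ge0.
have S02 : S0 ^+ 2 <= (s * g1 + 1) ^+ 2 * m ^+ 2.
  by rewrite -exprMn ler_sqr ?nnegrE//; exact: le_trans S0m.
have eb : (e (x' - xdag) : R) <= M * b by exact: e_le.
have seb := ler_wpM2l (sqr_ge0 (sigma n)) eb.
have b0 : 0 <= b by rewrite normr_ge0.
have r2 := sqr_ge0 `|yd - F x - dF x (x' - x)|.
(* completing the square in sigma n * b *)
have sq : 2 * (sigma n * b * m) <= c * (sigma n * b) ^+ 2 + c^-1 * m ^+ 2.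
  have ci0 : 0 <= c^-1 by rewrite invr_ge0 ltW.
  rewrite -subr_ge0.
  have -> : c * (sigma n * b) ^+ 2 + c^-1 * m ^+ 2 - 2 * (sigma n * b * m)
      = c^-1 * (c * (sigma n * b) - m) ^+ 2.
    by field; rewrite gt_eqF.
  by rewrite mulr_ge0// sqr_ge0.
have tot : 2 * a ^+ 2 + c * (sigma n * b) ^+ 2 <= Q ^+ 2 * m ^+ 2.
  have := ler_wpM2r (sqr_ge0 m) (gc_Q Co).
  move: sq S02 seb en r2; rewrite /m; lra.
have bC : b <= C1 * M.
  apply: le_of_sqr; first by rewrite mulr_ge0 ?(ltW C1_gt0)// ltW.
  have sc : 0 < c * sigma n ^+ 2 by rewrite mulr_gt0// exprn_gt0.
  rewrite -(ler_pM2l sc).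
  have := ler_wpM2r (sqr_ge0 m) (gc_C1 Co); have := sqr_ge0 a.
  move: tot; rewrite /m; lra.
have aQ : a <= Q * m.
  apply: le_of_sqr; first by rewrite ltW// mulr_gt0.
  have := sqr_ge0 a; have : 0 <= c * (sigma n * b) ^+ 2.
    by rewrite mulr_ge0 ?sqr_ge0// ltW.
  move: tot; rewrite exprMn; lra.
split=> //; first exact: st.1.
apply: (le_trans (T_next_le Bx xs bC)).
have sr := ler_wpM2l (ltW M_gt0) (gn_sigma_ratio S n).
have := ler_wpM2l (ltW nu_gt0) xT.
have := ler_wpM2r (ltW m0) (gc_nuC2 Co).
have q0 : 0 <= 2 * Q + 1 by rewrite addr_ge0// mulr_ge0// ltW.
have := ler_wpM2l q0 sr.
have m1 : 0 <= M * sigma n.+1 by rewrite ltW// mulr_gt0// (gn_sigma S).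
have := ler_wpM2r m1 (gc_C2 Co).
rewrite -/a; move: aQ; rewrite /m; lra.
Qed.

End GaussNewton.

(** * Residuals and decay before the iteration stops *)

Lemma subrACA (V : zmodType) (u v w z : V) : u - v - (w - z) = u - w - (v - z).
Proof. by rewrite !opprD !opprK addrACA. Qed.

Section Convergence.
Context {R : realType} {X Y : completeNormedModType R}.
Variables (F : X -> Y) (DF D : set X) (dF : X -> X -> Y) (xdag : X).
Variables (rho K0 K1 c s tau : R) (sigma : nat -> R).
Variables (g : X -> R) (e : X -> R^o) (x0 : X) (M : R).
Variables (g1 Q C1 C2 nu : R).
Hypothesis S : gn_setting F DF D dF xdag rho K0 K1 c s tau sigma g e x0 M.
Hypothesis Co : gn_constants dF xdag K0 K1 c s tau sigma M g1 Q C1 C2 nu.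

Local Notation y := (F xdag).
Local Notation T := (dF xdag).
Local Notation B := (ball xdag rho `&` DF).
Local Notation gn_run := (gn_run F D dF xdag rho sigma g x0).
Local Notation gn_step := (gn_step F D dF sigma g).
Local Notation good := (good D dF xdag sigma M C1 C2).

Lemma good_in_domain n x : ball xdag rho x -> good n x -> B x.
Proof. by move=> bx [Dx _ _]; split=> //; exact: (gn_sub S). Qed.

(** If the noise level is at least [g1 * M * sigma n.+1], the residual meets the
    discrepancy principle at index [n.+1]. *)
Lemma residual_stop n x x' yd delta :
  B x -> B x' -> good n x -> good n.+1 x' -> `|yd - y| <= delta ->
  g1 * M * sigma n.+1 <= delta -> gn_step yd n x x' ->
  `|F x' - yd| <= tau * delta.
Proof.
move=> Bx Bx' [_ xs xT] [_ x's _] ydd dn st.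
have sn := gn_sigma S n; have tau1 := gn_tau S; have M0 := gn_M S.
have s1 := gn_s S; have s0 : 0 < s by lra.
have nu0 := gc_nu0 Co; have nu4 := gc_nu4 Co; have g11 := gc_g1 Co.
have d0 : 0 <= delta by apply: le_trans ydd.
have C20 : 0 < C2 by apply: lt_le_trans (C2_ge S Co); have := gc_Q0 Co; lra.
set m := M * sigma n; have m0 : 0 < m by rewrite mulr_gt0.
have g1m : g1 * m <= s * delta.
  apply: (@le_trans _ _ (s * (g1 * M * sigma n.+1))); last by rewrite ler_pM2l.
  have := ler_wpM2l (mulr_ge0 (le_trans ler01 g11) (ltW M0)) (gn_sigma_ratio S n).
  by rewrite /m; lra.
have ms : m <= s * delta by apply: le_trans g1m; rewrite ler_peMl// ltW.
(* sigma n * eta is half of the margin (tau - 1) * delta *)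
pose eta := (tau - 1) * delta / (2 * sigma n).
have eta0 : 0 <= eta by rewrite divr_ge0 ?mulr_ge0 ?subr_ge0 ?(ltW tau1)// ltW.
have s_eta : sigma n * eta = (tau - 1) * delta / 2 by rewrite /eta; field; rewrite gt_eqF.
have e_eta : (e (x' - xdag) : R) <= eta ^+ 2.
  apply: (le_trans (e_le S _)).
  apply: (@le_trans _ _ (M * (C1 * M))); first by rewrite ler_pM2l.
  have k0 : 0 < 4 * s ^+ 2 * sigma n ^+ 2 by rewrite !mulr_gt0// exprn_gt0.
  rewrite -(ler_pM2l k0).
  have -> : 4 * s ^+ 2 * sigma n ^+ 2 * eta ^+ 2 = ((tau - 1) * (s * delta)) ^+ 2.
    by rewrite -mulrA -exprMn s_eta; field.
  apply: (@le_trans _ _ (((tau - 1) * (g1 * m)) ^+ 2)).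
    have := ler_wpM2r (sqr_ge0 m) (gc_C1g Co); rewrite /m; lra.
  have t1 : 0 <= tau - 1 by lra.
  have g0 : 0 <= g1 by lra.
  rewrite ler_sqr ?nnegrE; first by apply: ler_wpM2l.
    exact: mulr_ge0 t1 (mulr_ge0 g0 (ltW m0)).
  exact: mulr_ge0 t1 (mulr_ge0 (ltW s0) d0).
have [r_le a_le _] := step_energy_bounds S Co Bx xs ydd eta0 st e_eta.
rewrite s_eta in r_le a_le.
apply: (le_trans (residual_next_le S Co Bx xs yd Bx' x's)).
set r := `|yd - F x - _| in r_le *; set a := `|dF x _| in a_le *.
set t := `|T _| in xT r_le a_le *.
have tds : t <= C2 * (s * delta).
  apply: (le_trans xT); rewrite -mulrA ler_pM2l//.
have nut := ler_wpM2l (ltW nu0) tds.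
have t0 : 0 <= t by rewrite normr_ge0.
have nua := ler_wpM2l (ltW nu0) a_le.
have nunut := ler_wpM2r (mulr_ge0 (ltW nu0) t0) nu4.
have h1 := ler_wpM2r d0 (gc_nuC2s Co).
have h2 : nu * (256 + 48 * (tau - 1)) <= tau - 1.
  apply: le_trans (gc_nus Co).
  have p : 0 <= nu * (256 + 48 * (tau - 1)) by rewrite mulr_ge0 ?ltW//; lra.
  have ss : 1 <= s ^+ 2 by rewrite exprn_ege1.
  by have := ler_wpM2r p ss; lra.
have h3 := ler_wpM2r d0 h2.
have t1 : 0 <= tau - 1 by lra.
have h4 := mulr_ge0 (mulr_ge0 (ltW nu0) t1) d0.
have h5 := mulr_ge0 (ltW nu0) d0.
move: r_le nua nut nunut h1 h3 h4 h5; lra.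
Qed.

(** The same at the initial index. *)
Lemma residual_stop0 yd delta : ball xdag rho x0 -> `|yd - y| <= delta ->
  g1 * M * sigma 0 <= delta -> `|F x0 - yd| <= tau * delta.
Proof.
move=> b0 ydd dn; have [_ xs _] := good0 S Co.
have tau1 := gn_tau S; have sn := gn_sigma S 0.
have g0 : 0 <= g1 by apply: le_trans (gc_g1 Co).
have B0 : B x0 by have := good_in_domain b0 (good0 S Co).
have := residual_le S Co B0 xs; have := ler_distD y (F x0) yd.
rewrite [`|y - yd|]distrC.
have := le_opnorm (T_linear S) (x0 - xdag).
have := ler_wpM2r (normr_ge0 (x0 - xdag)) (gc_g1T Co).
have p : 0 <= sigma 0 * (tau - 1) * g1 by rewrite !mulr_ge0 ?(ltW sn)//; lra.
have := ler_wpM2l p (x0_dist_le S).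
have t1 : 0 <= tau - 1 by lra.
have := ler_wpM2l t1 dn; move: ydd; lra.
Qed.

Lemma sigma_small (a : R) : 0 < a -> exists n, forall m, (n <= m)%N -> sigma m <= a.
Proof.
move=> a0; have /cvgrPdist_lt/(_ a a0)[n _ nP] := gn_sigma_cvg S.
exists n => m /nP; rewrite /= sub0r normrN => h.
exact: le_trans (ler_norm _) (ltW h).
Qed.

Lemma C2_gt0 : 0 < C2.
Proof. by apply: lt_le_trans (C2_ge S Co); have := gc_Q0 Co; lra. Qed.

(** By the annihilator bound, [e] is small at the error of every [x] that satisfies
    the bounds for a large index. *)
Lemma e_small (eps : R) : 0 < eps ->
  exists n, forall m x, (n <= m)%N -> good m x -> (e (x - xdag) : R) <= eps.
Proof.
move=> eps0; have M0 := gn_M S; have C10 := C1_gt0 S Co; have C20 := C2_gt0.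
have CM : 0 < C1 * M by rewrite mulr_gt0.
have [A A0 eA] := gn_kernel S (divr_gt0 eps0 (mulr_gt0 (ltr0Sn _ _) CM : 0 < 2 * (C1 * M))).
have A1 : 0 < 2 * ((A + 1) * (C2 * M)).
  by rewrite !mulr_gt0//; lra.
have [n nP] := sigma_small (divr_gt0 eps0 A1).
exists n => m x /nP sm [_ xs xT].
apply: (le_trans (ler_norm _)); apply: (le_trans (eA _)).
have h1 : eps / (2 * (C1 * M)) * `|x - xdag| <= eps / 2.
  apply: (@le_trans _ _ (eps / (2 * (C1 * M)) * (C1 * M))).
    by rewrite ler_wpM2l// divr_ge0 ?ltW// mulr_gt0.
  by rewrite le_eqVlt; apply/orP; left; apply/eqP; field; rewrite !gt_eqF.
move: sm; rewrite ler_pdivlMr// => sm.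
have h2 := ler_wpM2l A0 xT.
have h3 : 0 <= C2 * M * sigma m by rewrite !mulr_ge0 ?ltW// (gn_sigma S).
move: h1 sm h2 h3; lra.
Qed.

(** A run of length [N] within the bounds such that, at each index from 2 to
    [N - 1], this index or the preceding one has a residual above [tau * delta]. *)
Definition active_run (delta : R) (yd : Y) (x : nat -> X) (N : nat) : Prop :=
  [/\ `|yd - y| <= delta, gn_run yd x N, forall n, (n <= N)%N -> good n (x n)
    & forall m, (2 <= m < N)%N ->
        tau * delta < Num.max `|F (x m) - yd| `|F (x m.-1) - yd|].

(** The estimates of one step, where [e] contributes at most [sigma n * eta]. *)
Lemma active_step (eta : R) : 0 < eta -> exists n1, forall delta yd x N n,
  active_run delta yd x N -> (n1 <= n < N)%N ->
  let E := delta + 2 * nu * `|T (x n - xdag)| + sigma n * eta in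
  [/\ `|T (x n.+1 - xdag)| <= 2 * E + 2 * nu * `|T (x n - xdag)|,
      `|F (x n.+1) - yd| <= E + 2 * nu * (E + 2 * `|T (x n - xdag)|)
    & sigma n ^+ 2 * c * `|x n.+1 - xdag| ^+ 2 <= E ^+ 2].
Proof.
move=> eta0; have [n1 n1P] := e_small (exprn_gt0 2 eta0).
exists n1 => delta yd x N n [ydd [_ st bx] gx _] /andP[n1n nN] E.
have nu0 := gc_nu0 Co.
have gn := gx _ (ltnW nN); have gn1 := gx _ nN.
have Bn := good_in_domain (bx _ (ltnW nN)) gn; have Bn1 := good_in_domain (bx _ nN) gn1.
have [_ xs _] := gn; have [_ x's _] := gn1.
have [] := step_energy_bounds S Co Bn xs ydd (ltW eta0) (st _ nN) (n1P n.+1 _ (leqW n1n) gn1).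
rewrite -/E => rE aE bE; split=> //.
- apply: (le_trans (T_next_le S Co Bn xs x's)).
  by rewrite lerD2r ler_pM2l.
- apply: (le_trans (residual_next_le S Co Bn xs yd Bn1 x's)).
  by rewrite lerD// ler_pM2l ?mulr_gt0// lerD2r.
Qed.

(** The two-step contraction: the lower bound [tau * delta] for one of the
    residuals bounds [delta], and then the bound [P] for the image of the error
    under [T], relative to [sigma], is halved. *)
Lemma active_halve (P : R) : 0 < P -> exists n1, forall delta yd x N k,
  active_run delta yd x N -> (n1 <= k)%N -> (k.+2 < N)%N ->
  `|T (x k - xdag)| <= P * sigma k ->
  `|T (x k.+1 - xdag)| <= P * sigma k.+1 ->
  delta <= P * sigma k.+2 /\ `|T (x k.+2 - xdag)| <= P / 2 * sigma k.+2.
Proof.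
move=> P0; have s1 := gn_s S; have tau1 := gn_tau S.
have nu0 := gc_nu0 Co; have nu4 := gc_nu4 Co.
have s20 : 0 < s ^+ 2 by rewrite exprn_gt0//; lra.
have t10 : 0 < tau - 1 by lra.
have den : 0 < 4 * s ^+ 2 * (8 + 2 * (tau - 1)).
  by rewrite !mulr_gt0//; lra.
(* with this eta the contribution of e is at most P / 4 after the division by tau - 1 *)
pose eta := (tau - 1) * P / (4 * s ^+ 2 * (8 + 2 * (tau - 1))).
have eta0 : 0 < eta by rewrite divr_gt0// mulr_gt0.
have [n1 n1P] := active_step eta0.
exists n1 => delta yd x N k ar n1k kN tk tk1.
have [_ rk1 _] := n1P _ _ _ _ k ar ltac:(rewrite n1k; exact: ltn_trans (ltn_trans (ltnSn _) (ltnSn _)) kN).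
have [tk2 rk2 _] := n1P _ _ _ _ k.+1 ar ltac:(rewrite (leqW n1k); exact: ltn_trans (ltnSn _) kN).
have [ydd _ _ /(_ k.+2 ltac:(exact: kN)) /= rtau] := ar.
have d0 : 0 <= delta by apply: le_trans ydd.
have sk2 := gn_sigma S k.+2; have sk1 := gn_sigma S k.+1; have sk := gn_sigma S k.
set w := s ^+ 2 * sigma k.+2; have w0 : 0 < w by rewrite mulr_gt0.
have sk1w : sigma k.+1 <= w.
  apply: (le_trans (gn_sigma_ratio S _)); rewrite ler_pM2r// expr2.
  by rewrite ler_peMl//; lra.
have skw : sigma k <= w.
  apply: (le_trans (gn_sigma_ratio S _)); rewrite /w expr2 -mulrA ler_pM2l; last by lra.
  exact: gn_sigma_ratio S _.
have tkw := le_trans tk (ler_wpM2l (ltW P0) skw).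
have tk1w := le_trans tk1 (ler_wpM2l (ltW P0) sk1w).
pose Es := delta + 2 * nu * (P * w) + w * eta.
have EkE : delta + 2 * nu * `|T (x k - xdag)| + sigma k * eta <= Es.
  have := ler_wpM2l (ltW nu0) tkw; have := ler_wpM2r (ltW eta0) skw.
  rewrite /Es; lra.
have Ek1E : delta + 2 * nu * `|T (x k.+1 - xdag)| + sigma k.+1 * eta <= Es.
  have := ler_wpM2l (ltW nu0) tk1w; have := ler_wpM2r (ltW eta0) sk1w.
  rewrite /Es; lra.
have nuEk := ler_wpM2l (ltW nu0) EkE; have nuEk1 := ler_wpM2l (ltW nu0) Ek1E.
have nutk := ler_wpM2l (ltW nu0) tkw; have nutk1 := ler_wpM2l (ltW nu0) tk1w.
have res_lt : tau * delta < Es + 2 * nu * Es + 4 * nu * (P * w).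
  apply: (lt_le_trans rtau); rewrite ge_max; apply/andP; split.
    by apply: (le_trans rk2); move: Ek1E nuEk1 nutk1; lra.
  by apply: (le_trans rk1); move: EkE nuEk nutk; lra.
have Pw0 : 0 < P * w by rewrite mulr_gt0.
have weta0 : 0 < w * eta by rewrite mulr_gt0.
have nuPw : 0 <= nu * (P * w) by rewrite ltW// mulr_gt0.
have nnPw := ler_wpM2l nuPw nu4.
have nweta := ler_wpM2l (ltW weta0) nu4.
have cst := ler_wpM2r (ltW (mulr_gt0 P0 sk2)) (gc_nus Co).
have ss : 1 <= s ^+ 2 by rewrite exprn_ege1.
have nu_tau : 256 * nu <= tau - 1.
  have p : 0 <= nu * (256 + 48 * (tau - 1)) by rewrite mulr_ge0 ?ltW//; lra.
  have q : 0 <= nu * (tau - 1) by rewrite mulr_ge0 ?ltW.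
  by have := ler_wpM2r p ss; have := gc_nus Co; move: q; lra.
have nud := ler_wpM2r d0 nu_tau.
have d_le : (tau - 1) * delta <= 14 * (nu * (P * w)) + 4 * (w * eta).
  move: res_lt; rewrite /Es; move: nnPw nweta nud; lra.
have eta_eq : w * eta * (8 + 2 * (tau - 1)) = (tau - 1) * (P * sigma k.+2) / 4.
  by rewrite /w /eta; field; rewrite !gt_eqF//; lra.
have tnu : 0 <= (tau - 1) * (nu * (P * w)) by rewrite mulr_ge0// ltW.
have teta : 0 <= (tau - 1) * (w * eta) by rewrite ltW// mulr_gt0.
split; rewrite -(ler_pM2l t10).
  move: nuPw d_le cst eta_eq tnu teta; rewrite /w; lra.
have tk2' : `|T (x k.+2 - xdag)| <= 2 * delta + 6 * (nu * (P * w)) + 2 * (w * eta).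
  by apply: (le_trans tk2); move: Ek1E nutk1; rewrite /Es; lra.
have := ler_wpM2l (ltW t10) tk2'.
move: nuPw tnu d_le cst eta_eq; rewrite /w; lra.
Qed.

(** Before a run stops, both the image of the error under [T] and the noise level
    become negligible against [sigma], uniformly in the data. *)
Lemma active_small (P : R) : 0 < P -> exists n1, forall delta yd x N m,
  active_run delta yd x N -> (n1 <= m < N)%N ->
  `|T (x m - xdag)| <= P * sigma m /\ delta <= P * sigma m.
Proof.
have CM : 0 < C2 * M by rewrite mulr_gt0 ?(C2_gt0) ?(gn_M S).
have halves j : exists n1, forall delta yd x N m,
    active_run delta yd x N -> (n1 <= m < N)%N ->
    `|T (x m - xdag)| <= C2 * M / 2 ^+ j * sigma m.
  elim: j => [|j [n1 IH]].
    exists 0%N => delta yd x N m [_ _ gx _] /andP[_ /ltnW mN].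
    by rewrite expr0 divr1; case: (gx m mN).
  have [n2 n2P] := active_halve (divr_gt0 CM (exprn_gt0 j (ltr0Sn _ 1))).
  exists (maxn n1 n2).+2 => delta yd x N [//|[//|m]] ar; rewrite !ltnS geq_max.
  move=> /andP[/andP[n1m n2m] mN].
  have := n2P _ _ _ _ m ar n2m mN.
  case.
  - by apply: (IH _ _ _ _ _ ar); rewrite n1m (ltnW (ltnW mN)).
  - by apply: (IH _ _ _ _ _ ar); rewrite (leqW n1m) (ltnW mN).
  by move=> _; rewrite exprSr invfM mulrA.
move=> P0.
have [j jP] : exists j, C2 * M / 2 ^+ j <= P.
  exists (Num.truncn (C2 * M / P)).+1; rewrite ler_pdivrMr ?exprn_gt0//.
  rewrite [leRHS]mulrC -ler_pdivrMr//; apply: le_trans (ltW (truncnS_gt _)) _.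
  by rewrite -natrX ler_nat ltnW// ltn_expl.
have [n1 n1P] := halves j; have [n2 n2P] := active_halve P0.
have small delta yd x N m : active_run delta yd x N -> (n1 <= m < N)%N ->
    `|T (x m - xdag)| <= P * sigma m.
  move=> ar mN; apply: (le_trans (n1P _ _ _ _ _ ar mN)).
  by rewrite ler_pM2r// (gn_sigma S).
exists (maxn n1 n2).+2 => delta yd x N [//|[//|m]] ar; rewrite !ltnS geq_max.
move=> /andP[/andP[n1m n2m] mN]; split.
  by apply: (small _ _ _ _ _ ar); rewrite mN !leqW.
have [//||//] := n2P _ _ _ _ m ar n2m mN.
- by apply: (small _ _ _ _ _ ar); rewrite n1m (ltnW (ltnW mN)).
- by apply: (small _ _ _ _ _ ar); rewrite (leqW n1m) (ltnW mN).
Qed.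

(** Long active runs end close to [xdag], uniformly in the data. *)
Lemma active_cvg (eps : R) : 0 < eps -> exists n1, forall delta yd x N,
  active_run delta yd x N -> (n1 <= N)%N -> `|x N - xdag| < eps.
Proof.
move=> eps0; have c0 := gn_c S; have nu4 := gc_nu4 Co; have nu0 := gc_nu0 Co.
pose k := eps * Num.min 1 c / 6.
have m0 : 0 < Num.min 1 c by rewrite lt_min ltr01.
have k0 : 0 < k by rewrite divr_gt0// mulr_gt0.
have [n1 n1P] := active_small k0; have [n2 n2P] := active_step k0.
exists (maxn n1 n2).+1 => delta yd x [//|N] ar; rewrite ltnS geq_max => /andP[h1 h2].
have [tN dN] := n1P _ _ _ _ N ar ltac:(by rewrite h1 leqnn).
have [_ _ bN] := n2P _ _ _ _ N ar ltac:(by rewrite h2 leqnn).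
have [ydd _ _ _] := ar; have d0 : 0 <= delta by apply: le_trans ydd.
have sN := gn_sigma S N.
set E := (_ + _ + _) in bN.
have E0 : 0 <= E by rewrite !addr_ge0// ?mulr_ge0// ltW.
have EE : E <= 3 * k * sigma N.
  have := ler_wpM2r (normr_ge0 (T (x N - xdag))) nu4; rewrite /E.
  have := normr_ge0 (T (x N - xdag)); move: tN dN; lra.
have E2 : E ^+ 2 <= (3 * k * sigma N) ^+ 2.
  by rewrite ler_sqr ?nnegrE//; exact: le_trans EE.
rewrite -(ltr_pXn2r (n := 2)) ?nnegrE// ?ltW//.
have sc : 0 < sigma N ^+ 2 * c by rewrite mulr_gt0// exprn_gt0.
rewrite -(ltr_pM2l sc); apply: (le_lt_trans (le_trans bN E2)).
have -> : (3 * k * sigma N) ^+ 2 = sigma N ^+ 2 * (Num.min 1 c ^+ 2 / 4 * eps ^+ 2).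
  by rewrite /k; field.
rewrite -[ltRHS]mulrA ltr_pM2l ?exprn_gt0// ltr_pM2r ?exprn_gt0//.
have m1 : Num.min 1 c <= 1 by rewrite ge_min lexx.
have m2 : Num.min 1 c <= c by rewrite ge_min lexx orbT.
move: m0 m1 m2; set q := Num.min 1 c; nra.
Qed.

(** * Behaviour at a fixed index *)

Lemma step_exists yd n x : B x -> exists x', gn_step yd n x x'.
Proof.
move=> Bx; apply: (exists_tikhonov_minimizer (c := c)).
- exact: gn_hilbert S.
- exact: base_linear S _ Bx.
- by rewrite exprn_gt0// (gn_sigma S).
- exact: gn_c S.
- exact: gn_strong S.
- exact: gn_closed S.
- by exists xdag; exact: gn_dag S.
- by exists (g x0) => u Du; apply: (gn_x0 S).2.
Qed.

(** The iterates for the data [yd]; a step at which the functional has no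
    minimizer is redirected to [x0]. *)
Fixpoint gn_seq (yd : Y) (n : nat) : X :=
  if n is k.+1 then xget x0 (gn_step yd k (gn_seq yd k)) else x0.

Lemma gn_seqP yd n : B (gn_seq yd n) ->
  gn_step yd n (gn_seq yd n) (gn_seq yd n.+1).
Proof. by move=> /(step_exists yd n); exact: xgetPex. Qed.

Lemma lipschitz_F x z : B x -> B z ->
  `|F x - F z| <= (1 + (K0 + K1) * `|x - z|) * (opnorm (dF z) * `|x - z|).
Proof.
move=> Bx Bz.
have := tangential_cone (gn_convex S) (gn_diff S) (gn_nonlin S) (gn_K0 S) (gn_K1 S) Bz Bx.
have := lerB_dist (F x - F z) (dF z (x - z)).
have p : 0 <= 1 + (K0 + K1) * `|x - z|.
  by rewrite addr_ge0// mulr_ge0// addr_ge0 ?(gn_K0 S) ?(gn_K1 S).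
have := ler_wpM2l p (le_opnorm (gn_diff S Bz).1 (x - z)); lra.
Qed.

(** If the derivative is constant on the ball, a small residual at index [n] gives
    a small error, by the energy inequality of the last step: the inequality
    [|r|^2 >= |s|^2 - 2 |s| |T e_n|] cancels [|s|^2]. *)
Lemma linear_fixed_cvg (n : nat) (eps : R) : K0 + K1 = 0 -> 0 < eps ->
  exists2 d0 : R, 0 < d0 & forall delta yd x, delta < d0 -> `|yd - y| <= delta ->
    gn_run yd x n -> (forall m, (m <= n)%N -> good m (x m)) ->
    `|F (x n) - yd| <= 2 * tau * delta -> `|x n - xdag| < eps.
Proof.
move=> K_eq eps0; have c0 := gn_c S; have M0 := gn_M S; have tau1 := gn_tau S.
have C10 := C1_gt0 S Co; have C20 := C2_gt0; have nu0 := gc_nu0 Co.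
have k0 : K0 = 0 by have := gn_K0 S; have := gn_K1 S; lra.
have k1 : K1 = 0 by have := gn_K0 S; have := gn_K1 S; lra.
pose r1 := C1 * M; have r10 : 0 < r1 by rewrite mulr_gt0.
have h0 : 0 < c * eps ^+ 2 / (4 * r1) by rewrite divr_gt0 ?mulr_gt0 ?exprn_gt0.
have [A A0 eA] := gn_kernel S h0.
pose L := 2 * (2 * tau + 1).
have L0 : 0 < L by rewrite /L; lra.
(* the index of the last step; for n = 0 there is none, and x0_energy is used *)
pose m := n.-1; have sm := gn_sigma S m.
pose W := 2 * (1 + 2 * nu * (C2 * M * sigma m)) / sigma m ^+ 2 + A.
have W0 : 0 <= W.
  by rewrite addr_ge0// divr_ge0 ?sqr_ge0// mulr_ge0// addr_ge0// !mulr_ge0// ltW.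
have WL : 0 < 4 * (W * L + 1) by rewrite mulr_gt0// ltr_wpDl// mulr_ge0// ltW.
exists (Num.min 1 (c * eps ^+ 2 / (4 * (W * L + 1)))).
  by rewrite lt_min ltr01 divr_gt0// mulr_gt0// exprn_gt0.
move=> delta yd x; rewrite lt_min => /andP[d1 d2] ydd rn gx res.
have d0 : 0 <= delta by apply: le_trans ydd.
have [x_0 st bx] := rn.
have gn := gx n (leqnn n); have Bn := good_in_domain (bx n (leqnn n)) gn.
have [Dn xs xT] := gn.
have tL : `|T (x n - xdag)| <= L * delta.
  apply: (le_trans (T_le_residual S Co Bn xs)).
  by have := ler_distD yd (F (x n)) y; move: res ydd; rewrite /L; lra.
have e_le' : (e (x n - xdag) : R) <= c * eps ^+ 2 / 4 + A * (L * delta).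
  apply: (le_trans (ler_norm _)); apply: (le_trans (eA _)).
  rewrite lerD ?ler_wpM2l//.
  apply: (@le_trans _ _ (c * eps ^+ 2 / (4 * r1) * r1)); first by rewrite ler_pM2l.
  by rewrite le_eqVlt; apply/orP; left; apply/eqP; field; rewrite gt_eqF.
have main : c * `|x n - xdag| ^+ 2 <= W * (L * delta) + c * eps ^+ 2 / 4.
  have Ld0 : 0 <= L * delta by rewrite mulr_ge0// ltW.
  have AW : A * (L * delta) <= W * (L * delta).
    apply: ler_wpM2r => //; rewrite /W lerDr divr_ge0 ?sqr_ge0// mulr_ge0//.
    by rewrite addr_ge0// !mulr_ge0// ltW.
  have [n0|n0] := posnP n.
    move: e_le' AW; rewrite n0 x_0 => e_le' AW.
    by have := (x0_energy S); move: e_le' AW; lra.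
  have nE : n = m.+1 by rewrite prednK.
  have mn : (m < n)%N by rewrite nE.
  have gm := gx m (ltnW mn); have Bm := good_in_domain (bx m (ltnW mn)) gm.
  have [_ ms mT] := gm.
  have stm : gn_step yd m (x m) (x n) by have := st m mn; rewrite -nE.
  have en := step_energy S Bm stm.
  have s_le := linearization_le S Co Bm ms ydd.
  have a_le : `|dF (x m) (x n - xdag)| <= L * delta.
    apply: le_trans tL.
    have := gn_nonlin S (x n - xdag) (xdag_in_domain S) Bm; rewrite k0 k1 !mul0r addr0.
    by have := lerB_dist (dF (x m) (x n - xdag)) (T (x n - xdag)); lra.
  set a := `|dF (x m) (x n - xdag)| in en a_le.
  set S0 := `|yd - F (x m) - dF (x m) (xdag - x m)| in en s_le.
  have rS : S0 - a <= `|yd - F (x m) - dF (x m) (x n - x m)|.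
    have -> : x n - x m = (x n - xdag) + (xdag - x m) by rewrite addrA subrK.
    rewrite (bounded_linearD (base_linear S Bm)) opprD addrCA addrC.
    by rewrite /S0 /a; exact: lerB_dist.
  set r := `|yd - F (x m) - dF (x m) (x n - x m)| in en rS.
  have a0 : 0 <= a by exact: normr_ge0.
  have S00 : 0 <= S0 by exact: normr_ge0.
  have r0 : 0 <= r by exact: normr_ge0.
  have r2 : S0 ^+ 2 - 2 * (S0 * a) <= r ^+ 2.
    have [Sa|Sa] := leP a S0; first by nra.
    by have := sqr_ge0 r; nra.
  have S0le : S0 <= 1 + 2 * nu * (C2 * M * sigma m).
    have := ler_wpM2l (ltW nu0) mT; move: s_le d1; lra.
  have Sa : S0 * a <= (1 + 2 * nu * (C2 * M * sigma m)) * (L * delta).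
    exact: ler_pM.
  have sm2 : 0 < sigma m ^+ 2 by rewrite exprn_gt0.
  rewrite -(ler_pM2l sm2).
  have -> : sigma m ^+ 2 * (W * (L * delta) + c * eps ^+ 2 / 4) =
      2 * ((1 + 2 * nu * (C2 * M * sigma m)) * (L * delta))
      + sigma m ^+ 2 * (c * eps ^+ 2 / 4 + A * (L * delta)).
    by rewrite /W; field; rewrite gt_eqF.
  have := ler_wpM2l (ltW sm2) e_le'; have := sqr_ge0 a.
  move: en r2 Sa; lra.
have dW : 4 * (W * L + 1) * delta < c * eps ^+ 2.
  by move: d2; rewrite ltr_pdivlMr// mulrC.
rewrite -(ltr_pXn2r (n := 2)) ?nnegrE// ?ltW// -(ltr_pM2l c0).
have ce : 0 < c * eps ^+ 2 by rewrite mulr_gt0// exprn_gt0.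
move: main dW ce d0; lra.
Qed.

(** The minimizer of the next step depends continuously on the base point and
    on the data. *)
Lemma step_stability n z z' : B z -> gn_step y n z z' ->
  `|z - xdag| <= C1 * M -> `|z' - xdag| <= C1 * M ->
  exists2 W : R, 0 <= W & forall yd delta x x', B x -> gn_step yd n x x' ->
    `|x - xdag| <= C1 * M -> `|x' - xdag| <= C1 * M ->
    `|yd - y| <= delta -> delta + `|x - z| <= 1 ->
    `|x' - z'| ^+ 2 <= W * (delta + `|x - z|).
Proof.
move=> Bz stz zs z's.
have zl := base_linear S Bz.
have K_ge0 : 0 <= K0 + K1 by rewrite addr_ge0 ?(gn_K0 S) ?(gn_K1 S).
have k00 := gn_K0 S; have k10 := gn_K1 S.
pose r1 := C1 * M; have r10 : 0 <= r1 by apply: le_trans zs.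
pose La := opnorm (dF z); have La0 : 0 <= La by exact: opnorm_ge0 zl.
pose A1 := 1 + La * (2 + (K0 + K1) + 2 * (K0 + K1) * r1).
pose A2 := `|y - F z| + 2 * La * r1.
have A20 : 0 <= A2 by rewrite /A2 addr_ge0// mulr_ge0// mulr_ge0.
have Kr0 : 0 <= 2 + (K0 + K1) + 2 * (K0 + K1) * r1.
  by rewrite addr_ge0 ?addr_ge0 ?(mulr_ge0 (mulr_ge0 _ K_ge0) r10)// ler0n.
have LK0 := mulr_ge0 La0 Kr0.
have A10 : 0 <= A1 by rewrite /A1 addr_ge0.
have sc : 0 < sigma n ^+ 2 * c by rewrite mulr_gt0 ?(gn_c S)// exprn_gt0// (gn_sigma S).
pose W := A1 * (2 * A2 + A1) / (sigma n ^+ 2 * c).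
exists W; first by rewrite /W divr_ge0 ?(ltW sc)// mulr_ge0// addr_ge0// mulr_ge0.
move=> yd delta x x' Bx st xs x's ydd small.
have xl := base_linear S Bx.
set d := delta + `|x - z| in small *.
have delta0 : 0 <= delta by apply: le_trans ydd.
have d0 : 0 <= d by rewrite addr_ge0.
have dist w : `|w - xdag| <= r1 -> `|w - x| <= 2 * r1 /\ `|w - z| <= 2 * r1.
  move=> ws; have := ler_distD xdag w x; have := ler_distD xdag w z.
  rewrite ![`|xdag - _|]distrC; move: ws xs zs; rewrite -/r1.
  by split; lra.
have Fxz : `|F x - F z| <= (1 + (K0 + K1)) * (La * `|x - z|).
  apply: (le_trans (lipschitz_F Bx Bz)); apply: ler_wpM2r.
    by rewrite mulr_ge0.
  rewrite lerD2l ler_piMr//; move: small delta0; rewrite /d; lra.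
have dFxz v : `|dF x v - dF z v| <= (K0 + K1) * La * `|x - z| * `|v|.
  have := gn_nonlin S v Bz Bx.
  have h1 := ler_wpM2l (mulr_ge0 k00 (normr_ge0 (x - z))) (le_opnorm zl v).
  have h2 := ler_wpM2r (normr_ge0 v) (ler_wpM2l k10 (le_opnorm zl (x - z))).
  move: h1 h2; rewrite -/La; lra.
pose q (w : X) := `|yd - F x - dF x (w - x)|.
pose qz (w : X) := `|y - F z - dF z (w - z)|.
have diff w : `|w - xdag| <= r1 ->
    `|(yd - F x - dF x (w - x)) - (y - F z - dF z (w - z))| <= A1 * d.
  move=> ws; have [wx wz] := dist w ws.
  have -> : (yd - F x - dF x (w - x)) - (y - F z - dF z (w - z)) =
      (yd - y) - (F x - F z) - ((dF x (w - x) - dF z (w - x)) + dF z (z - x)).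
    have -> : dF z (z - x) = dF z (w - x) - dF z (w - z).
      by rewrite -(bounded_linearB zl) opprB [_ + (z - w)]addrC addrA subrK.
    by rewrite addrA subrK subrACA; congr (_ - _); rewrite subrACA.
  apply: (le_trans (ler_normB _ _)).
  apply: (le_trans (lerD (ler_normB _ _) (ler_normD _ _))).
  have := dFxz (w - x); have := le_opnorm zl (z - x); rewrite [`|z - x|]distrC -/La.
  have P : 0 <= (K0 + K1) * La * `|x - z| by rewrite !mulr_ge0.
  have := ler_wpM2l P wx; move: Fxz ydd.
  have : 0 <= La * (2 + (K0 + K1) + 2 * (K0 + K1) * r1) * delta.
    exact: mulr_ge0.
  have : 0 <= `|x - z| by [].
  rewrite /A1 /d; lra.
have sq_diff w : `|w - xdag| <= r1 -> `|q w ^+ 2 - qz w ^+ 2| <= A1 * (2 * A2 + A1) * d.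
  move=> ws; have [wx wz] := dist w ws; have dw := diff w ws.
  have qzA : qz w <= A2.
    apply: (le_trans (ler_normB _ _)); rewrite lerD2l.
    by have := le_opnorm zl (w - z); have := ler_wpM2l La0 wz; rewrite -/La; lra.
  have qq : `|q w - qz w| <= A1 * d by exact: le_trans (ler_dist_dist _ _) dw.
  have q0 : 0 <= q w by exact: normr_ge0.
  have qz0 : 0 <= qz w by exact: normr_ge0.
  have -> : q w ^+ 2 - qz w ^+ 2 = (q w - qz w) * (q w + qz w) by ring.
  rewrite normrM [A1 * _ * d]mulrAC; apply: ler_pM => //.
  rewrite ger0_norm ?addr_ge0//.
  have A1d : A1 * d <= A1 by rewrite ler_piMr.
  by move: qq; rewrite ler_norml => /andP[_]; move: qzA A1d; lra.
have gx := tikhonov_gap (gn_hilbert S) xl (sqr_ge0 (sigma n)) (gn_strong S) st stz.1.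
have gz := tikhonov_gap (gn_hilbert S) zl (sqr_ge0 (sigma n)) (gn_strong S) stz st.1.
have := sq_diff _ x's; have := sq_diff _ z's.
rewrite !ler_norml => /andP[_ h1] /andP[h2 _].
rewrite -(ler_pM2l sc).
have -> : sigma n ^+ 2 * c * (W * d) = A1 * (2 * A2 + A1) * d.
  by rewrite /W; field; rewrite !gt_eqF ?(gn_c S) ?(gn_sigma S).
move: gx gz h1 h2; rewrite /tikhonov /q /qz [`|z' - x'|]distrC.
have := sqr_ge0 `|dF x (z' - x')|; have := sqr_ge0 `|dF z (x' - z')|.
lra.
Qed.

(** If the error bound is smaller than the radius, all iterates within the bounds
    lie in the ball. *)
Section InnerBall.
Hypothesis C1_rho : C1 * M < rho.

Lemma good_ball n x : good n x -> ball xdag rho x.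
Proof.
by move=> [_ xs _]; rewrite -ball_normE /= distrC; exact: le_lt_trans C1_rho.
Qed.

(** For exact data the noise level is zero, so the bounds hold at all indices. *)
Lemma exact_good n : good n (gn_seq y n).
Proof.
elim: n => [|n IH]; first exact: good0 S Co.
have bn := good_ball IH.
have d0 : `|y - y| <= 0 by rewrite subrr normr0.
apply: (good_step S Co bn IH d0).
  by rewrite !mulr_ge0// ?ltW ?(gn_sigma S) ?(gn_M S)//;
    [apply: lt_le_trans (gn_s S)|apply: lt_le_trans (gc_g1 Co)].
apply: (gn_seqP); exact: (good_in_domain bn IH).
Qed.

Lemma exactB n : B (gn_seq y n).
Proof. have gn := exact_good n; exact: (good_in_domain (good_ball gn) gn). Qed.

(** Stability: at a fixed index the iterates converge to those for exact data. *)
Lemma run_stability n (eps : R) : 0 < eps ->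
  exists2 d0 : R, 0 < d0 & forall delta yd x, delta < d0 -> `|yd - y| <= delta ->
    gn_run yd x n -> (forall m, (m <= n)%N -> good m (x m)) ->
    `|x n - gn_seq y n| < eps.
Proof.
elim: n eps => [|n IH] eps eps0.
  by exists 1 => // delta yd x _ _ [-> _ _] _; rewrite subrr normr0.
have gz := exact_good n; have gz' := exact_good n.+1.
have [W W0 WP] := step_stability (exactB n) (gn_seqP (exactB n))
  (let: And3 _ h _ := gz in h) (let: And3 _ h _ := gz' in h).
pose h := Num.min 1 (eps ^+ 2 / (W + 1)) / 2.
have W1 : 0 < W + 1 by rewrite ltr_wpDl.
have h0 : 0 < h by rewrite divr_gt0// lt_min ltr01 divr_gt0// exprn_gt0.
have [d1 d10 d1P] := IH h h0.
exists (Num.min d1 h); first by rewrite lt_min d10.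
move=> delta yd x; rewrite lt_min => /andP[dd1 dh] ydd [x_0 st bx] gx.
have rn : gn_run yd x n.
  by split=> // m mn; [apply: st; exact: ltnW|apply: bx; exact: ltnW].
have gx' m : (m <= n)%N -> good m (x m) by move=> mn; apply: gx; exact: ltnW.
have xz := d1P delta yd x dd1 ydd rn gx'.
have gn := gx' n (leqnn n); have gn1 := gx n.+1 (leqnn _).
have Bn : B (x n) := good_in_domain (bx n (leqnSn n)) gn.
have [_ xs _] := gn; have [_ x's _] := gn1.
have hm : h * 2 <= 1 by rewrite divfK ?pnatr_eq0// ge_min lexx.
have hW : h * 2 <= eps ^+ 2 / (W + 1).
  by rewrite divfK ?pnatr_eq0// ge_min lexx orbT.
rewrite -(ltr_pXn2r (n := 2)) ?nnegrE// ?ltW//.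
apply: (le_lt_trans (WP yd delta (x n) (x n.+1) Bn (st n (ltnSn n)) xs x's ydd _)).
  by move: dh xz hm; lra.
move: hW; rewrite ler_pdivlMr// => hW.
have dx : delta + `|x n - gn_seq y n| < h * 2 by lra.
have p := ler_wpM2l W0 (ltW dx); move: p hW h0; lra.
Qed.

(** If the exact iterate at index [n] solves the equation it is [xdag], and
    stability applies; otherwise the residual at index [n] stays away from [0]. *)
Lemma nonlinear_fixed_cvg n (eps : R) :
  (forall x, B x -> F x = y -> x = xdag) -> 0 < eps ->
  exists2 d0 : R, 0 < d0 & forall delta yd x, delta < d0 -> `|yd - y| <= delta ->
    gn_run yd x n -> (forall m, (m <= n)%N -> good m (x m)) ->
    `|F (x n) - yd| <= 2 * tau * delta -> `|x n - xdag| < eps.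
Proof.
move=> uniq eps0; set z := gn_seq y n; have Bz : B z := exactB n.
have [Fz|Fz] := pselect (F z = y).
  have [d0 d00 d0P] := run_stability n eps0.
  exists d0 => // delta yd x dd ydd rn gx _.
  by have := d0P delta yd x dd ydd rn gx; rewrite -/z (uniq z Bz Fz).
(* the exact iterate has a positive residual, which excludes small noise levels *)
have r0 : 0 < `|F z - y| by rewrite normr_gt0 subr_eq0; apply/eqP.
set r := `|F z - y| in r0.
have K_ge0 : 0 <= K0 + K1 by rewrite addr_ge0 ?(gn_K0 S) ?(gn_K1 S).
pose La := opnorm (dF z); have La0 : 0 <= La by exact: opnorm_ge0 (base_linear S Bz).
have W1 : 0 < 2 * ((1 + (K0 + K1)) * La + 1).
  by rewrite mulr_gt0// ltr_wpDl// mulr_ge0// addr_ge0.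
pose h := Num.min 1 (r / (2 * ((1 + (K0 + K1)) * La + 1))).
have h0 : 0 < h by rewrite lt_min ltr01 divr_gt0.
have [d0 d00 d0P] := run_stability n h0.
have tau1 := gn_tau S.
have tau2 : 0 < 2 * (2 * tau + 1) by lra.
exists (Num.min d0 (r / (2 * (2 * tau + 1)))); first by rewrite lt_min d00 divr_gt0.
move=> delta yd x; rewrite lt_min => /andP[dd dr] ydd rn gx res; exfalso.
have xz := d0P delta yd x dd ydd rn gx; rewrite -/z in xz.
have Bx : B (x n).
  by have [_ _ bx] := rn; exact: (good_in_domain (bx n (leqnn n)) (gx n (leqnn n))).
have L := lipschitz_F Bx Bz; rewrite -/La in L.
move: xz; rewrite lt_min => /andP[xz1]; rewrite ltr_pdivlMr// => xz2.
move: dr; rewrite ltr_pdivlMr// => dr.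
have L' : `|F (x n) - F z| <= (1 + (K0 + K1)) * La * `|x n - z|.
  apply: (le_trans L); rewrite mulrA; apply: ler_wpM2r => //; apply: ler_wpM2r => //.
  by rewrite lerD2l ler_piMr// ltW.
have := ler_distD (F (x n)) (F z) y; rewrite -/r [`|F z - _|]distrC => t1.
have := ler_distD yd (F (x n)) y => t2.
have nx : 0 <= `|x n - z| by [].
move: t1 t2 L' xz2 dr res ydd nx; lra.
Qed.

End InnerBall.

(** * Stopped runs *)

Variables (r : stopping_rule) (yd : R -> Y).
Hypothesis yd_close : forall delta, 0 < delta -> `|yd delta - y| <= delta.

(** [x 0, ..., x N] are the first iterates for the data [yd delta], whether or not
    they lie in the ball. *)
Definition gn_iter (delta : R) (x : nat -> X) (N : nat) : Prop :=
  x 0%N = x0 /\ forall n, (n < N)%N -> gn_step (yd delta) n (x n) (x n.+1).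

(** The stopping rule returns the given index. *)
Definition gn_stop (delta : R) (x : nat -> X) : nat -> Prop :=
  stops_at r (tau * delta) (fun n => `|F (x n) - yd delta|).

Hypothesis in_ball : forall delta x N, 0 < delta -> gn_iter delta x N ->
  (forall m, (m < N)%N -> ~ gn_stop delta x m) -> good N (x N) ->
  ball xdag rho (x N).

Lemma gn_iterW delta x m n : (m <= n)%N -> gn_iter delta x n -> gn_iter delta x m.
Proof. by move=> mn [x_0 st]; split=> // k km; apply: st; exact: leq_trans mn. Qed.

(** Until it stops, the iteration stays in the ball and within the bounds, provided
    that the noise level is dominated by the [sigma m]. *)
Lemma unstopped_run delta x N : 0 < delta -> gn_iter delta x N ->
  (forall m, (m < N)%N -> ~ gn_stop delta x m) ->
  (forall m, (m < N)%N -> delta <= s * g1 * M * sigma m) ->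
  gn_run (yd delta) x N /\ forall n, (n <= N)%N -> good n (x n).
Proof.
move=> d0; elim: N => [|N IH] it ns ds.
  have gd0 : good 0 (x 0%N) by rewrite it.1; exact: good0 S Co.
  split; last by move=> n; rewrite leqn0 => /eqP ->.
  split=> //; first exact: it.1.
  by move=> n; rewrite leqn0 => /eqP ->; apply: (in_ball d0 it).
have [[_ _ bx] gx] := IH (gn_iterW (leqnSn N) it)
  (fun m mN => ns m (ltnW mN)) (fun m mN => ds m (ltnW mN)).
have gN : good N.+1 (x N.+1).
  apply: (good_step S Co (bx N (leqnn N)) (gx N (leqnn N)) (yd_close d0)).
    exact: ds.
  exact: it.2.
have gall n : (n <= N.+1)%N -> good n (x n).
  by rewrite leq_eqVlt => /predU1P[->//|]; rewrite ltnS; exact: gx.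
split=> //; split; [exact: it.1|exact: it.2|move=> n].
by rewrite leq_eqVlt => /predU1P[->|]; [exact: (in_ball d0 it ns gN)|rewrite ltnS; exact: bx].
Qed.

(** There is an index below which the noise level is dominated by the [sigma m] and
    by which the iteration has stopped. *)
Lemma stop_bound delta : 0 < delta -> exists Nb : nat,
  (forall m, (m < Nb)%N -> delta <= s * g1 * M * sigma m) /\
  (forall x, gn_iter delta x Nb -> exists2 n, (n <= Nb)%N & gn_stop delta x n).
Proof.
move=> d0; have M0 := gn_M S; have g11 := gc_g1 Co; have s1 := gn_s S.
have gM : 0 < g1 * M by rewrite mulr_gt0//; lra.
have exN : exists N, g1 * M * sigma N <= delta.
  have [N NP] := sigma_small (divr_gt0 d0 gM).
  by exists N; rewrite mulrC -ler_pdivlMr// NP.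
(* Nb is 0 if N = 0 and N + 1 otherwise: then the residuals at N and N + 1 are small *)
case: (ex_minnP exN) => N NP Nmin.
have [N0|N0] := posnP N.
  exists 0%N; split=> // x it; exists 0%N => //; apply: stops_at0.
  have gd0 := good0 S Co.
  have b0 : ball xdag rho x0.
    by rewrite -it.1; apply: (in_ball d0 it) => //; rewrite it.1.
  by rewrite it.1; apply: (residual_stop0 b0 (yd_close d0)); rewrite -N0.
have before m : (m < N)%N -> delta < g1 * M * sigma m.
  by move=> mN; rewrite ltNge; apply/negP => /Nmin; rewrite leqNgt mN.
have ds m : (m < N.+1)%N -> delta <= s * g1 * M * sigma m.
  rewrite -mulrA -mulrA [g1 * _]mulrA ltnS leq_eqVlt => /predU1P[->|mN].
    have pN : (N.-1 < N)%N by rewrite ltn_predL.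
    apply: (le_trans (ltW (before _ pN))); rewrite mulrCA ler_pM2l//.
    by have := gn_sigma_ratio S N.-1; rewrite prednK.
  apply: (le_trans (ltW (before _ mN))); rewrite ler_peMl//.
  by rewrite ltW// mulr_gt0// (gn_sigma S).
exists N.+1; split=> // x it.
have [[m [mN sm]]|ns] := pselect (exists m, (m < N.+1)%N /\ gn_stop delta x m).
  by exists m => //; exact: ltnW.
have [[_ st bx] gx] := unstopped_run d0 it
  (fun m mN sm => ns (ex_intro _ m (conj mN sm))) ds.
have Bx n : (n <= N.+1)%N -> B (x n).
  by move=> nN; exact: (good_in_domain (bx n nN) (gx n nN)).
have res n : (n < N.+1)%N -> g1 * M * sigma n.+1 <= delta ->
    `|F (x n.+1) - yd delta| <= tau * delta.
  move=> nN dn; apply: (residual_stop (Bx n (ltnW nN)) (Bx _ nN) (gx n (ltnW nN))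
    (gx _ nN) (yd_close d0) dn (st n nN)).
apply: (stops_at_exists r N0 (res := fun n => `|F (x n) - yd delta|)).
- have pN : (N.-1 < N.+1)%N by rewrite ltnS leq_pred.
  by have := res N.-1 pN; rewrite prednK//; apply.
- apply: res => //; apply: le_trans NP; rewrite ler_pM2l//.
  exact: gn_sigma_noninc S N.
Qed.

(** A stopped iteration stays in the ball and within the bounds. *)
Lemma stopped_run delta x N : 0 < delta -> gn_iter delta x N -> gn_stop delta x N ->
  gn_run (yd delta) x N /\ forall n, (n <= N)%N -> good n (x n).
Proof.
move=> d0 it sN; have [Nb [ds ex]] := stop_bound d0.
have ns m : (m < N)%N -> ~ gn_stop delta x m by move=> mN; exact: stops_at_first sN mN.
have NNb : (N <= Nb)%N.
  rewrite leqNgt; apply/negP => NbN.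
  have [n nNb sn] := ex x (gn_iterW (ltnW NbN) it).
  exact: ns n (leq_ltn_trans nNb NbN) sn.
by apply: unstopped_run => // m mN; apply: ds; exact: leq_trans NNb.
Qed.

Lemma stopped_run_exists delta : 0 < delta -> exists x N,
  [/\ gn_iter delta x N, gn_stop delta x N & forall n, (n <= N)%N -> B (x n)].
Proof.
move=> d0; have [Nb [ds ex]] := stop_bound d0.
pose x := gn_seq (yd delta).
have it N : (N <= Nb)%N -> (forall m, (m < N)%N -> ~ gn_stop delta x m) ->
    gn_iter delta x N.
  elim: N => [|N IH] NNb ns; first by split.
  have ns' m : (m < N)%N -> ~ gn_stop delta x m by move=> mN; apply: ns; exact: ltnW.
  have itN := IH (ltnW NNb) ns'.
  have [] := unstopped_run d0 itN ns' (fun m mN => ds m (leq_trans mN (ltnW NNb))).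
  move=> [_ _ bx] gx; split=> // n; rewrite ltnS leq_eqVlt => /predU1P[->|]; last exact: itN.2.
  apply: (gn_seqP); exact: (good_in_domain (bx N (leqnn N)) (gx N (leqnn N))).
have [N NNb sN] : exists2 N, (N <= Nb)%N & gn_stop delta x N.
  have [[m [mN sm]]|ns] := pselect (exists m, (m < Nb)%N /\ gn_stop delta x m).
    by exists m => //; exact: ltnW.
  by apply: ex; apply: it => // m mN sm; apply: ns; exists m.
have itN : gn_iter delta x N.
  by apply: it => // m mN; exact: stops_at_first sN mN.
exists x, N; split=> // n nN.
have [[_ _ bx] gx] := stopped_run d0 itN sN.
exact: (good_in_domain (bx n nN) (gx n nN)).
Qed.

Hypothesis fixed_cvg : forall n (eps : R), 0 < eps ->
  exists2 d0 : R, 0 < d0 & forall delta yd x, delta < d0 -> `|yd - y| <= delta ->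
    gn_run yd x n -> (forall m, (m <= n)%N -> good m (x m)) ->
    `|F (x n) - yd| <= 2 * tau * delta -> `|x n - xdag| < eps.

(** Large stopping indices are covered by [active_cvg], and the finitely many
    others by [fixed_cvg]. *)
Lemma stopped_cvg (eps : R) : 0 < eps -> exists2 d0 : R, 0 < d0 &
  forall delta x N, 0 < delta < d0 -> gn_iter delta x N -> gn_stop delta x N ->
    `|x N - xdag| < eps.
Proof.
move=> eps0; have [n1 n1P] := active_cvg eps0.
have [d0 d00 d0P] : exists2 d0 : R, 0 < d0 & forall n, (n < n1)%N ->
    forall delta yd x, delta < d0 -> `|yd - y| <= delta ->
    gn_run yd x n -> (forall m, (m <= n)%N -> good m (x m)) ->
    `|F (x n) - yd| <= 2 * tau * delta -> `|x n - xdag| < eps.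
  elim: n1 {n1P} => [|k [d1 d10 d1P]]; first by exists 1.
  have [d2 d20 d2P] := fixed_cvg k eps0.
  exists (Num.min d1 d2); first by rewrite lt_min d10.
  move=> n; rewrite ltnS leq_eqVlt => /predU1P[->|nk] delta yd' x;
    rewrite lt_min => /andP[h1 h2]; first exact: d2P.
  exact: d1P.
exists d0 => // delta x N /andP[dl0 dl] it sN.
have [rn gx] := stopped_run dl0 it sN.
have [n1N|Nn1] := leqP n1 N.
  apply: (n1P delta (yd delta) x N) => //; split=> //; first exact: yd_close.
  by move=> m mN; exact: (stops_at_active sN mN).
apply: (d0P N Nn1 delta (yd delta)) => //; first exact: yd_close.
rewrite -mulrA; apply: (stops_at_residual _ sN) => k; exact: normr_ge0.
Qed.

End Convergence.

(** * Choice of the constants *)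

(** The constants other than [M] depend only on [c], [s], [tau], the first [sigma]
    and the norm of the derivative at [xdag]; the smallness condition is the only
    constraint on [M]. *)
Lemma gn_constants_exist {R : realType} {X Y : completeNormedModType R}
    (dF : X -> X -> Y) (xdag : X) (K0 K1 c s tau : R) (sigma : nat -> R) :
  0 < c -> 1 <= s -> 1 < tau -> 0 < sigma 0%N -> 0 <= opnorm (dF xdag) ->
  exists g1 Q C1 C2 nu : R, [/\ 0 < C1, 0 < nu & forall M,
    (K0 + K1) * (C1 * M) <= nu ->
    gn_constants dF xdag K0 K1 c s tau sigma M g1 Q C1 C2 nu].
Proof.
move=> c0 s1 tau1 s0; set t := opnorm _ => t0.
have s00 : 0 < s by lra.
have d0 : 0 < tau - 1 by lra.
have ci0 : 0 < c^-1 by rewrite invr_gt0.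
have cci : c * c^-1 = 1 by rewrite mulfV// gt_eqF.
pose A1 := 2 * s + 3 + c^-1; have A10 : 0 < A1 by rewrite /A1; lra.
pose A0 := A1 * (c^-1 + 1); have A00 : 0 < A0 by rewrite mulr_gt0//; lra.
pose h1 := 4 * s ^+ 2 * A0 / (tau - 1) ^+ 2.
have h10 : 0 <= h1.
  by rewrite divr_ge0 ?sqr_ge0// mulr_ge0 ?(ltW A00)// mulr_ge0 ?sqr_ge0.
pose h2 := 2 * t / (c * sigma 0%N * (tau - 1)).
have csd : 0 < c * sigma 0%N * (tau - 1) by rewrite !mulr_gt0.
have h20 : 0 <= h2 by rewrite divr_ge0 ?(ltW csd)// mulr_ge0.
pose g1 := 1 + h1 + h2; have g11 : 1 <= g1 by rewrite /g1; lra.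
have g10 : 0 < g1 by lra.
pose Q := g1 * A1; have Q0 : 0 < Q by rewrite mulr_gt0.
pose C1 := g1 * A0; have C10 : 0 < C1 by rewrite mulr_gt0.
have cs : 0 < c * sigma 0%N by rewrite mulr_gt0.
pose C2 := s * (2 * Q + 1) + t / (c * sigma 0%N).
have C20 : 0 < C2.
  by rewrite ltr_wpDr ?divr_ge0 ?(ltW cs)// mulr_gt0//; lra.
(* nu is the inverse of b, which dominates the factor of nu in each upper bound *)
pose b1 := 16 * C2 * s / (tau - 1).
have b10 : 0 <= b1 by rewrite divr_ge0 ?(ltW d0)// !mulr_ge0// ltW.
pose b2 := 8 * s ^+ 2 * (32 + 6 * (tau - 1)) / (tau - 1).
have b20 : 0 <= b2.
  by rewrite divr_ge0 ?(ltW d0)// !mulr_ge0 ?sqr_ge0//; lra.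
pose b := 4 + 2 * C2 + b1 + b2; have b0 : 0 < b by rewrite /b; lra.
have nu0 : 0 < b^-1 by rewrite invr_gt0.
have nub k : k <= b -> b^-1 * k <= 1 by move=> kb; rewrite mulrC ler_pdivrMr// mul1r.
exists g1, Q, C1, C2, b^-1; split=> // M small; split=> //.
- have ss : s * g1 + 1 <= g1 * (s + 1) by lra.
  have sg0 : 0 <= s * g1 + 1 by rewrite addr_ge0// ltW// mulr_gt0.
  have s2 : (s * g1 + 1) ^+ 2 <= (g1 * (s + 1)) ^+ 2.
    by rewrite ler_sqr ?nnegrE//; exact: le_trans ss.
  have g2 : 1 <= g1 ^+ 2 by rewrite exprn_ege1.
  have A12 : 2 * (s + 1) ^+ 2 + c^-1 <= A1 ^+ 2.
    rewrite /A1; have := sqr_ge0 c^-1; have : 0 <= s * c^-1 by rewrite ltW// mulr_gt0.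
    have := sqr_ge0 s; lra.
  have := ler_wpM2r (ltW ci0) g2; have := ler_wpM2l (sqr_ge0 g1) A12.
  move: s2; rewrite /Q; lra.
- have -> : c * C1 ^+ 2 = Q ^+ 2 * (c^-1 + 2 + c).
    by rewrite /C1 /A0 /Q; field; rewrite gt_eqF.
  by apply: ler_peMr; [exact: sqr_ge0|lra].
- rewrite /C1 /A0.
  have -> : c * (g1 * (A1 * (c^-1 + 1))) = g1 * (A1 * (1 + c)) by field; rewrite gt_eqF.
  have h : 1 <= A1 * (1 + c).
    by have := mulr_gt0 A10 c0; rewrite /A1; lra.
  by have := ler_wpM2l (ltW g10) h; lra.
- have h : 4 * s ^+ 2 * A0 <= (tau - 1) ^+ 2 * g1.
    by rewrite [leRHS]mulrC -ler_pdivrMr ?exprn_gt0// -/h1 /g1; lra.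
  have := ler_wpM2l (ltW g10) h; rewrite /C1; lra.
- have : h2 <= g1 by rewrite /g1; lra.
  by rewrite /h2 ler_pdivrMr// => h; rewrite [leRHS]mulrC.
- by rewrite /C2 lerDl divr_ge0// ltW.
- rewrite [leRHS]mulrC -ler_pdivrMr// /C2 lerDr mulr_ge0//; lra.
- have := nub 4 ltac:(rewrite /b; lra); lra.
- have := nub (2 * C2) ltac:(rewrite /b; lra); lra.
- have := nub b1 ltac:(rewrite /b; lra); rewrite /b1 mulrA ler_pdivrMr//; lra.
- have := nub b2 ltac:(rewrite /b; lra); rewrite /b2 mulrA ler_pdivrMr//; lra.
Qed.

(** * Reduction to a real-valued penalty *)

Section EffectiveDomain.
Context {R : realType} {X : normedModType R}.
Variables (Theta : X -> \bar R) (DF : set X).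
Hypothesis Theta_proper : proper_fun Theta.

(** The effective domain of the restriction of [Theta] to [DF]; on it the
    penalty is handled as a real function. *)
Definition eff_dom : set X := DF `&` dom Theta.

Local Notation D := eff_dom.
Local Notation th := (fun x => fine (Theta x)).
Local Notation ThetaF := (restrict_fun Theta DF).

Lemma Theta_fin x : dom Theta x -> Theta x = (fine (Theta x))%:E.
Proof.
move=> dx; rewrite fineK// fin_numE; apply/andP; split.
  by rewrite gt_eqF// Theta_proper.1.
by rewrite lt_eqF.
Qed.

Lemma restrict_fin x : D x -> ThetaF x = (fine (Theta x))%:E.
Proof. by move=> [Dx dx]; rewrite /restrict_fun /patch mem_set// Theta_fin. Qed.

Lemma restrict_pinfty x : ~ D x -> ThetaF x = +oo%E.
Proof.
move=> nD; rewrite /restrict_fun /patch; case: ifPn => // /set_mem Dx.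
apply/eqP; rewrite -leye_eq leNgt; apply/negP => dx; apply: nD; exact: conj Dx dx.
Qed.

Lemma eff_dom_strongly_convex (C0 : R) :
  convex_set (DF : set (convex_lmodType X)) ->
  (forall x z (l : R), (0 < l < 1)%R ->
      (Theta (l *: z + (1 - l) *: x)%R + (C0 * l * (1 - l) * `|z - x| ^+ 2)%:E
      <= l%:E * Theta z + (1 - l)%:E * Theta x)%E) ->
  strongly_convex D C0 th.
Proof.
move=> cDF cTh u z t [Du du] [Dz dz] t01; have := cTh u z t t01.
rewrite (Theta_fin du) (Theta_fin dz) -!EFinM -EFinD => h.
have t01' : 0 <= t <= 1 by move/andP: t01 => [? ?]; rewrite !ltW.
have dm : dom Theta (t *: z + (1 - t) *: u).
  apply: contrapT => /negP; rewrite -leNgt leye_eq => /eqP E.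
  by move: h; rewrite E.
split; first by split => //; exact: convex_set_comb.
by move: h; rewrite (Theta_fin dm) -EFinD lee_fin /=; lra.
Qed.

Lemma eff_dom_closed_sublevels : closed DF -> lower_semicontinuous Theta ->
  closed_sublevels D th.
Proof.
move=> cDF lsc; apply/closed_sublevelsP => w B h.
have Dw : DF w.
  apply: cDF => V /nbhs_ballP[e /= e0 eV].
  by have [u [[Du _] wu _]] := h e e0; exists u; split=> //; apply: eV; rewrite -ball_normE.
have ThB : (Theta w <= B%:E)%E.
  rewrite leNgt; apply/negP => /lsc[V /nbhs_ballP[e /= e0 eV] VB].
  have [u [[Du du] wu uB]] := h e e0.
  have : V u by apply: eV; rewrite -ball_normE.
  by move=> /VB; rewrite (Theta_fin du) lte_fin ltNge uB.
have dw : dom Theta w by apply: le_lt_trans ThB _; rewrite ltry.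
by split=> //; move: ThB; rewrite (Theta_fin dw) lee_fin.
Qed.

Lemma subdiff_real xi x z : D x -> D z -> subdiff ThetaF x xi ->
  0 <= fine (Theta z) - fine (Theta x) - (xi (z - x) : R).
Proof.
by move=> Dx Dz [_ /(_ z)]; rewrite /bregman !restrict_fin.
Qed.

(** Minimizers of an extended real functional that is finite on the effective
    domain only. *)
Lemma unique_minimizer_minimizes (f : X -> \bar R) (f' : X -> R) (k : R) x :
  D !=set0 -> (forall w, D w -> f w = (f' w + k)%:E) ->
  (forall w, ~ D w -> f w = +oo%E) -> unique_minimizer f x -> minimizes D f' x.
Proof.
move=> [d Dd] fD fnD [xmin _].
have Dx : D x.
  by apply: contrapT => nD; have := xmin d; rewrite (fnD _ nD) (fD _ Dd).
split=> // z Dz; have := xmin z.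
by rewrite !fD// lee_fin lerD2r.
Qed.

Lemma minimizes_unique_minimizer (f : X -> \bar R) (f' : X -> R) (k a : R) x :
  (forall w, D w -> f w = (f' w + k)%:E) ->
  (forall w, ~ D w -> f w = +oo%E) -> 0 < a ->
  (forall u z, minimizes D f' u -> D z -> f' u + a * `|z - u| ^+ 2 <= f' z) ->
  minimizes D f' x -> unique_minimizer f x.
Proof.
move=> fD fnD a0 gap xm; have [Dx xmin] := xm; split=> [z|x' x'min].
  have [Dz|nD] := pselect (D z); last by rewrite (fnD _ nD) leey.
  by rewrite !fD// lee_fin lerD2r xmin.
have Dx' : D x'.
  by apply: contrapT => nD; have := x'min x; rewrite (fnD _ nD) (fD _ Dx).
have := gap x x' xm Dx'; have := x'min x; rewrite !fD// lee_fin lerD2r => h1 h2.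
have n0 : `|x' - x| ^+ 2 <= 0.
  by rewrite -(ler_pM2l a0) mulr0; lra.
apply/eqP; rewrite -subr_eq0 -normr_eq0 -sqrf_eq0 eq_le n0/=; exact: sqr_ge0.
Qed.

Lemma gn_functional_fin (Y : normedModType R) (F : X -> Y) (dF : X -> X -> Y)
    (xi0 : X -> R^o) x0 (a : R) (yd : Y) xn w :
  bounded_linear xi0 -> D x0 -> D w ->
  gn_functional F dF ThetaF xi0 x0 a yd xn w =
  (`|yd - F xn - dF xn (w - xn)| ^+ 2 + a * (fine (Theta w) - (xi0 w : R))
    - a * (fine (Theta x0) - (xi0 x0 : R)))%:E.
Proof.
move=> xil D0 Dw; rewrite /gn_functional /bregman !restrict_fin//.
have -> : (xi0 (w - x0) : R) = (xi0 w : R) - (xi0 x0 : R).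
  exact: bounded_linearB xil w x0.
by rewrite -!EFinB -EFinM -EFinD; congr EFin; ring.
Qed.

Lemma gn_functional_pinfty (Y : normedModType R) (F : X -> Y) (dF : X -> X -> Y)
    (xi0 : X -> R^o) x0 (a : R) (yd : Y) xn w : 0 < a -> D x0 -> ~ D w ->
  gn_functional F dF ThetaF xi0 x0 a yd xn w = +oo%E.
Proof.
move=> a0 D0 nD; rewrite /gn_functional /bregman (restrict_pinfty nD) restrict_fin//.
by rewrite !addye// gt0_muley ?lte_fin// addey.
Qed.

End EffectiveDomain.

(** * The regularized Gauss-Newton method *)

Lemma sqrt_scaling {R : realType} (alpha : nat -> R) (theta : R) :
  scaling_sequence alpha theta ->
  [/\ forall n, 0 < Num.sqrt (alpha n),
      forall n, Num.sqrt (alpha n.+1) <= Num.sqrt (alpha n),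
      forall n, Num.sqrt (alpha n) <= Num.sqrt theta * Num.sqrt (alpha n.+1)
    & Num.sqrt (alpha n) @[n --> \oo] --> (0 : R)].
Proof.
move=> [a0 ar ac]; split.
- by move=> n; rewrite sqrtr_gt0.
- move=> n; apply: ler_wsqrtr; have /andP[+ _] := ar n.
  by rewrite ler_pdivlMr// mul1r.
- move=> n; have /andP[h1 h2] := ar n.
  rewrite -sqrtrM; last by apply: le_trans h2; apply: le_trans h1.
  by apply: ler_wsqrtr; rewrite -ler_pdivrMr.
- have : Num.sqrt (alpha n) @[n --> \oo] --> Num.sqrt (0 : R).
    by apply: continuous_cvg => //; exact: sqrt_continuous.
  by rewrite sqrtr0.
Qed.

Theorem theorem5p2 (R : realType) (X Y : completeNormedModType R)
  (Theta : X -> \bar R) (gamma : R)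
  (F : X -> Y) (DF : set X) (dF : X -> X -> Y) (y : Y) (xdag : X)
  (rho K0 K1 theta tau : R) (alpha : nat -> R)
  (ThetaF := restrict_fun Theta DF) (T := dF xdag)
  (Xrefl : reflexive_space X) (Yhilb : hilbert_space Y)
  (Theta_proper : proper_fun Theta) (Theta_lsc : lower_semicontinuous Theta)
  (Theta_conv : two_convex Theta) (Theta_gamma : two_convex_const Theta gamma)
  (DF_closed : closed DF) (DF_convex : convex_set (DF : set (convex_lmodType X)))
  (xdag_dom : (DF `&` dom_subdiff Theta) xdag) (xdag_sol : F xdag = y)
  (rho_gt0 : 0 < rho)
  (F_diff : has_directional_derivatives F DF dF xdag rho)
  (T_scaled : opnorm T <= Num.sqrt (alpha 0%N) / gamma)
  (K0_ge0 : 0 <= K0) (K1_ge0 : 0 <= K1)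
  (F_nonlin : nonlinearity_condition DF dF xdag rho K0 K1)
  (theta_gt1 : 1 < theta) (alpha_seq : scaling_sequence alpha theta)
  (xdag_unique : forall x, (ball xdag rho `&` DF) x -> F x = y -> x = xdag)
  (tau_gt1 : 1 < tau) :
  exists2 eps : R, 0 < eps &
  forall (xi0 xidag : X -> R^o) (x0 : X),
    dual_space X xi0 ->
    unique_minimizer (fun x => (ThetaF x - (xi0 x)%:E)%E) x0 ->
    unique_nearest xi0 (subdiff ThetaF xdag) xidag ->
    ker_perp T (xi0 - xidag) ->
    (K0 + K1) * opnorm (xi0 - xidag) < eps ->
  forall (r : stopping_rule) (yd : R -> Y)
    (iter := fun delta => gn_iterates F dF ThetaF xi0 x0 alpha (yd delta))
    (stop := fun delta (x : nat -> X) =>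
       stops_at r (tau * delta) (fun n => `|F (x n) - yd delta|)),
    (forall delta, 0 < delta -> `|yd delta - y| <= delta) ->
    (* the iteration only uses the operators F'(x) for x in the ball; this has
       to be required only when K0 = K1 = 0, where the smallness condition on
       (K0 + K1) * opnorm (xi0 - xidag) is void *)
    (K0 + K1 = 0 ->
      forall delta x N, 0 < delta -> iter delta x N ->
        (forall m, (m < N)%N -> ~ stop delta x m) ->
        forall n, (n <= N)%N -> ball xdag rho (x n)) ->
    (forall delta, 0 < delta ->
      exists x N, [/\ iter delta x N, stop delta x N
        & forall n, (n <= N)%N -> (ball xdag rho `&` DF) (x n)]) /\
    (forall (x : R -> nat -> X) (n_ : R -> nat),
      (forall delta, 0 < delta ->
        iter delta (x delta) (n_ delta) /\ stop delta (x delta) (n_ delta)) ->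
      x delta (n_ delta) @[delta --> (0 : R)^'+] --> xdag).
Proof.
have [C0 C00 Theta_C0] := Theta_conv.
have xdagD : eff_dom Theta DF xdag by split; [exact: xdag_dom.1|exact: xdag_dom.2.1].
have Bxdag : (ball xdag rho `&` DF) xdag by split; [exact: ballxx|exact: xdag_dom.1].
have Tl : bounded_linear T := (F_diff _ Bxdag).1.
have alpha0 n : 0 < alpha n by case: alpha_seq.
have [sg0 sg_noninc sg_ratio sg_cvg] := sqrt_scaling alpha_seq.
pose sigma n := Num.sqrt (alpha n).
have sg2 n : sigma n ^+ 2 = alpha n by rewrite sqr_sqrtr// ltW.
have s1 : 1 <= Num.sqrt theta by rewrite -[leLHS]sqrtr1 ler_wsqrtr// ltW.
have K_ge0 : 0 <= K0 + K1 by rewrite addr_ge0.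
have [g1 [Q [C1 [C2 [nu [C10 nu0 consts]]]]]] :=
  @gn_constants_exist R X Y dF xdag K0 K1 C0 (Num.sqrt theta) tau sigma C00 s1 tau_gt1
    (sg0 0%N) (opnorm_ge0 Tl).
pose eps := if K0 + K1 == 0 then 1 else Num.min nu ((K0 + K1) * rho) / C1.
have eps0 : 0 < eps.
  rewrite /eps; case: ifPn => // K_neq0; rewrite divr_gt0// lt_min nu0 mulr_gt0//.
  by rewrite lt_neqAle eq_sym K_neq0.
exists eps => // xi0 xidag x0 xi0l x0_min [xidag_sub _ _] e_perp e_small
  r yd iter stop yd_close balls.
have el : dual_space X (xi0 - xidag) := e_perp.1.
pose e := xi0 - xidag.
(* a positive bound M for the norm of e that still meets the smallness condition *)
have [M [M0 Me KC1M C1M]] : exists M, [/\ 0 < M, opnorm e <= M,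
    (K0 + K1) * (C1 * M) <= nu & K0 + K1 = 0 \/ C1 * M < rho].
  have [K_eq|K_neq0] := eqVneq (K0 + K1) 0.
    exists (opnorm e + 1); rewrite K_eq mul0r; split; [|lra|exact: ltW|by left].
    by rewrite ltr_wpDl// opnorm_ge0.
  have K_gt0 : 0 < K0 + K1 by rewrite lt_neqAle eq_sym K_neq0.
  have e0 := opnorm_ge0 el.
  pose M := (opnorm e + eps / (K0 + K1)) / 2.
  have M_eps : opnorm e < eps / (K0 + K1) by rewrite ltr_pdivlMr// mulrC.
  have M0 : 0 < M by rewrite divr_gt0// ltr_wpDl// divr_gt0.
  have KM : (K0 + K1) * M < eps.
    by rewrite mulrC -ltr_pdivlMr// /M; lra.
  have : (K0 + K1) * M * C1 < Num.min nu ((K0 + K1) * rho).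
    by move: KM; rewrite /eps (negbTE K_neq0) ltr_pdivlMr.
  rewrite lt_min => /andP[h1 h2].
  exists M; split=> //; first by rewrite /M; lra.
    by rewrite ltW// [C1 * _]mulrC mulrA.
  by right; rewrite -(ltr_pM2l K_gt0) [C1 * _]mulrC mulrA.
pose D := eff_dom Theta DF.
pose g : X -> R := fun u => fine (Theta u) - (xi0 u : R).
have g_strong : strongly_convex D C0 g.
  by apply: strongly_convex_tilt => //; exact: eff_dom_strongly_convex.
have Dx : D !=set0 by exists xdag.
have x0m : minimizes D g x0.
  apply: (@unique_minimizer_minimizes _ _ Theta DF _ g 0 _ Dx _ _ x0_min) => w Dw.
    by rewrite addr0 /ThetaF restrict_fin// -EFinB.
  by rewrite /ThetaF restrict_pinfty.
have x0D : D x0 := x0m.1.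
have S : gn_setting F DF D dF xdag rho K0 K1 C0 (Num.sqrt theta) tau sigma g e x0 M.
  split=> //.
  - by move=> u [].
  - by apply: closed_sublevels_tilt => //; exact: eff_dom_closed_sublevels.
  - move=> z Dz; have := subdiff_real Theta_proper xdagD Dz xidag_sub.
    rewrite /g /e.
    have -> : ((xi0 - xidag) (z - xdag) : R) = (xi0 (z - xdag) : R) - (xidag (z - xdag) : R) by [].
    have -> : (xi0 (z - xdag) : R) = (xi0 z : R) - (xi0 xdag : R) := bounded_linearB xi0l z xdag.
    by lra.
  - move=> v; apply: (le_trans (le_opnorm el v)); exact: ler_wpM2r.
  - exact: kernel_annihilator_bound Xrefl Yhilb Tl e_perp.
have Co := consts M KC1M.
(* the functionals of the theorem and of gn_step differ by a constant on D *)
have step_of_min delta n xn x' :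
    unique_minimizer (gn_functional F dF ThetaF xi0 x0 (alpha n) (yd delta) xn) x' ->
    gn_step F D dF sigma g (yd delta) n xn x'.
  apply: (@unique_minimizer_minimizes _ _ Theta DF _ _
    (- (alpha n * (fine (Theta x0) - (xi0 x0 : R)))) _ Dx) => w Dw.
    by rewrite gn_functional_fin// /tikhonov sg2.
  exact: gn_functional_pinfty.
have min_of_step delta n xn x' : (ball xdag rho `&` DF) xn ->
    gn_step F D dF sigma g (yd delta) n xn x' ->
    unique_minimizer (gn_functional F dF ThetaF xi0 x0 (alpha n) (yd delta) xn) x'.
  move=> Bn.
  apply: (@minimizes_unique_minimizer _ _ Theta DF _ _
    (- (alpha n * (fine (Theta x0) - (xi0 x0 : R)))) (sigma n ^+ 2 * C0)).
  - by move=> w Dw; rewrite gn_functional_fin// /tikhonov sg2.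
  - by move=> w nD; exact: gn_functional_pinfty.
  - by rewrite sg2 mulr_gt0.
  - move=> u z um Dz; have := tikhonov_gap Yhilb (F_diff _ Bn).1 (sqr_ge0 _) g_strong um Dz.
    by have := sqr_ge0 `|dF xn (z - u)|; lra.
have iter_gn delta x N : iter delta x N -> gn_iter F D dF sigma g x0 yd delta x N.
  by move=> [x_0 st]; split=> // n nN; exact: step_of_min (st n nN).
have gn_D delta x N n : gn_iter F D dF sigma g x0 yd delta x N -> (n <= N)%N -> D (x n).
  by move=> [x_0 st]; case: n => [|n] nN; [rewrite x_0|exact: (st n nN).1].
have gn_iter_iter delta x N : gn_iter F D dF sigma g x0 yd delta x N ->
    (forall n, (n < N)%N -> ball xdag rho (x n)) -> iter delta x N.
  move=> it bx; split=> [|n nN]; first exact: it.1.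
  apply: min_of_step; last exact: it.2.
  by split; [exact: bx|exact: (gn_D _ _ _ _ it (ltnW nN)).1].
have yd_close' delta : 0 < delta -> `|yd delta - F xdag| <= delta.
  by rewrite xdag_sol; exact: yd_close.
have in_ball delta x N : 0 < delta -> gn_iter F D dF sigma g x0 yd delta x N ->
    (forall m, (m < N)%N -> ~ gn_stop F tau r yd delta x m) ->
    good D dF xdag sigma M C1 C2 N (x N) -> ball xdag rho (x N).
  move=> d0 it ns gN; case: C1M => [K_eq|C1M]; last exact: (good_ball C1M gN).
  (* uniqueness of the minimizers needs the base points in the ball: strong induction *)
  suff /(_ N (leqnn N)) : forall n, (n <= N)%N -> ball xdag rho (x n) by [].
  elim/ltn_ind => n IH nN.
  apply: (balls K_eq delta x n d0 _ _ n (leqnn n)).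
    apply: gn_iter_iter; first exact: gn_iterW nN it.
    by move=> m mn; apply: IH => //; exact: leq_trans (ltnW mn) nN.
  by move=> m mn; apply: ns; exact: leq_trans mn nN.
have fixed : forall n (ep : R), 0 < ep -> exists2 d0 : R, 0 < d0 &
    forall delta yd' x, delta < d0 -> `|yd' - F xdag| <= delta ->
    gn_run F D dF xdag rho sigma g x0 yd' x n ->
    (forall m, (m <= n)%N -> good D dF xdag sigma M C1 C2 m (x m)) ->
    `|F (x n) - yd'| <= 2 * tau * delta -> `|x n - xdag| < ep.
  move=> n ep ep0; case: C1M => [K_eq|C1M]; first exact: linear_fixed_cvg S Co _ _ K_eq ep0.
  apply: (nonlinear_fixed_cvg S Co C1M) => // x Bx; rewrite xdag_sol; exact: xdag_unique.
split.
- move=> delta d0; have [x [N [it st bx]]] := stopped_run_exists S Co yd_close' in_ball d0.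
  exists x, N; split=> //; apply: gn_iter_iter it _ => n nN.
  by case: (bx n (ltnW nN)).
- move=> x n_ run; apply/cvgrPdist_lt => ep ep0.
  have [d0 d00 d0P] := stopped_cvg S Co yd_close' in_ball fixed ep0.
  exists d0 => //= delta /=; rewrite sub0r normrN => dd dl0.
  have [it st] := run delta dl0.
  rewrite distrC; apply: (d0P delta) => //; last exact: iter_gn.
  by rewrite dl0 (le_lt_trans (ler_norm _) dd).
Qed.
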